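(* Let $(W,\mathrm{d})$ be a closed Hilbert complex with domain complex $(V,\mathrm{d})$, and let $(W_h,\mathrm{d}_h)$ be a family of Hilbert complexes, parametrized by $h$, with domain complexes $(V_h,\mathrm{d}_h)$, equipped with $W$-bounded inclusion morphisms $i_h\colon V_h\hookrightarrow V$ and $V$-bounded projection morphisms $\pi_h\colon V\to V_h$, with bounds uniform in $h$, satisfying $\pi_h\circ i_h=\mathrm{id}_{V_h}$. Let $F\colon V^k\to W^k$ be monotone and hemicontinuous, let $F_h\colon V_h^k\to W_h^k$ be monotone, and let $f\in W^k$, $f_h\in W_h^k$. Let $(\sigma,u,p)\in V^{k-1}\times V^k\times\mathfrak{H}^k$ be the solution of $$\begin{aligned}\langle\sigma,\tau\rangle-\langle u,\mathrm{d}\tau\rangle&=0&&\forall\tau\in V^{k-1},\\ \langle\mathrm{d}\sigma,v\rangle+\langle\mathrm{d}u,\mathrm{d}v\rangle+\langle p,v\rangle+\langle F(u+p),v\rangle&=\langle f,v\rangle&&\forall v\in V^k,\\ \langle u,q\rangle&=0&&\forall q\in\mathfrak{H}^k,\end{aligned}$$ and let $(\sigma_h,u_h,p_h)\in V_h^{k-1}\times V_h^k\times\mathfrak{H}_h^k$ be the solution of $$\begin{aligned}\langle\sigma_h,\tau_h\rangle_h-\langle u_h,\mathrm{d}_h\tau_h\rangle_h&=0&&\forall\tau_h\in V_h^{k-1},\\ \langle\mathrm{d}_h\sigma_h,v_h\rangle_h+\langle\mathrm{d}_hu_h,\mathrm{d}_hv_h\rangle_h+\langle p_h,v_h\rangle_h+\langle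 F_h(u_h+p_h),v_h\rangle_h&=\langle f_h,v_h\rangle_h&&\forall v_h\in V_h^k,\\ \langle u_h,q_h\rangle_h&=0&&\forall q_h\in\mathfrak{H}_h^k.\end{aligned}$$ If $F_h$ is Lipschitz (with respect to the $V_h$-norm), and its Lipschitz constant is uniformly bounded in $h$, then there is a constant $C$, independent of $h$, such that $$\begin{aligned}&\|\sigma-i_h\sigma_h\|_V+\|u-i_hu_h\|_V+\|p-i_hp_h\|\\&\quad\le C\Bigl(\inf_{\tau\in i_hV_h^{k-1}}\|\sigma-\tau\|_V+\inf_{v\in i_hV_h^k}\|u-v\|_V+\inf_{q\in i_hV_h^k}\|p-q\|_V+\mu\inf_{v\in i_hV_h^k}\|P_{\mathfrak{B}}u-v\|_V\\&\qquad+\bigl\|i_h^*(f-F(u+p))-(f_h-F_hP_{V_h}(u+p))\bigr\|_h+\|I-J_h\|\,\|f-F(u+p)\|\Bigr),\end{aligned}$$ where $$\mu=\sup_{r\in\mathfrak{H}^k,\ \|r\|=1}\|(I-i_h\pi_h^k)r\|.$$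
   Context: All Hilbert spaces are real. A Hilbert complex $(W,\mathrm{d})$ is a sequence of Hilbert spaces $W^k$ with closed, densely defined linear maps $\mathrm{d}^k\colon V^k\subset W^k\to V^{k+1}\subset W^{k+1}$ (possibly unbounded) such that $\mathrm{d}^k\circ\mathrm{d}^{k-1}=0$. It is closed if each image $\mathrm{d}^kV^k$ is closed in $W^{k+1}$. The inner product and norm of $W^k$ are $\langle\cdot,\cdot\rangle$, $\|\cdot\|$; those of $W_h^k$ are $\langle\cdot,\cdot\rangle_h$, $\|\cdot\|_h$. The domain complex $(V,\mathrm{d})$ consists of the domains $V^k$ with the graph inner product $\langle u,v\rangle_V=\langle u,v\rangle+\langle\mathrm{d}^ku,\mathrm{d}^kv\rangle$ and norm $\|\cdot\|_V$; the norm $\|\cdot\|_{V_h}$ on $V_h$ is defined in the same way from $\langle\cdot,\cdot\rangle_h$ and $\mathrm{d}_h$. Degree indices on differentials are suppressed. Put $\mathfrak{Z}^k=\ker\mathrm{d}^k$, $\mathfrak{B}^k=\mathrm{d}^{k-1}V^{k-1}$, $\mathfrak{H}^k=\mathfrak{Z}^k\cap\mathfrak{B}^{k\perp}$ (harmonic space), and $\mathfrak{H}_h^k$ is the analogous space for $(W_h,\mathrm{d}_h)$, with orthogonality in $\langle\cdot,\cdot\rangle_h$. $P_{\mathfrak{B}}$ is the $W$-orthogonal projection onto $\mathfrak{B}^k$. A morphism between complexes is a family of linear maps, one in each degree, mapping domains to domains and commuting with the differentials. $i_h$ is injective and $W$-bounded, i.e. bounded with respect to $\|\cdot\|_h$ and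 $\|\cdot\|$, so it also defines a bounded map $i_h\colon W_h\to W$; $i_h^*\colon W\to W_h$ is its adjoint with respect to $\langle\cdot,\cdot\rangle$ and $\langle\cdot,\cdot\rangle_h$. It need not be unitary. $\pi_h$ is bounded with respect to $\|\cdot\|_V$ and $\|\cdot\|_{V_h}$. Set $J_h=i_h^*i_h$ on $W_h$; $\|I-J_h\|$ is its operator norm on $W_h$ (maximum over the degrees $k-1,k,k+1$ of the operator norm on $W_h^j$). $P_{V_h}\colon V\to V_h$ is the map such that $i_hP_{V_h}v$ is the $V$-orthogonal projection of $v$ onto $i_hV_h\subset V$. $F\colon V^k\to W^k$ is monotone if $\langle Fu-Fv,u-v\rangle\ge0$ for all $u,v\in V^k$, and hemicontinuous if $t\mapsto\langle F(u+tv),w\rangle$ is continuous on $[0,1]$ for all $u,v\in V^k$, $w\in W^k$. Monotonicity of $F_h\colon V_h^k\to W_h^k$ is defined in the same way using $\langle\cdot,\cdot\rangle_h$. $F_h$ is Lipschitz if $\|F_hu_h-F_hv_h\|_h\le C_F\|u_h-v_h\|_{V_h}$ for all $u_h,v_h\in V_h^k$. *)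

(* Defs.v *)
From HB Require Import structures.
From mathcomp Require Import all_boot all_order all_algebra.
From mathcomp Require Import sesquilinear.
From mathcomp Require Import all_classical all_reals all_analysis.

Set Implicit Arguments.
Unset Strict Implicit.
Unset Printing Implicit Defensive.

Import Order.TTheory GRing.Theory Num.Theory.
Import numFieldNormedType.Exports.

Local Open Scope classical_set_scope.
Local Open Scope ring_scope.

(* Completeness is that of the norm, which is the one of the inner product. *)
HB.mixin Record isHilbert (R : realType) (E : Type)
    & CompleteNormedModule R E := {
  inner : {dot E for idfun};
  inner_norm : forall x : E, inner x x = `|x| ^+ 2
}.

#[short(type="hilbertType")]
HB.structure Definition Hilbert (R : realType) :=
  { E of isHilbert R E & CompleteNormedModule R E }.

(* Degrees range over [int], so that no degree is special.  A map defined on  *)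
(* the domain [dom k] only is represented by a function on the whole space,   *)
(* whose values outside [dom k] are arbitrary and never used.                 *)
Record hilbert_complex (R : realType) := HilbertComplex {
  hspace :> int -> hilbertType R;
  dom : forall k : int, set (hspace k);
  d : forall k : int, hspace k -> hspace (k + 1);
  dom0 : forall k, @dom k 0;
  dom_lin : forall k (a : R) (x y : hspace k),
    @dom k x -> @dom k y -> @dom k (a *: x + y);
  d_lin : forall k (a : R) (x y : hspace k),
    @dom k x -> @dom k y -> d (a *: x + y) = a *: d x + d y;
  dom_dense : forall k, dense (@dom k);
  d_closed : forall k, closed
    [set xy : (hspace k * hspace (k + 1))%type | @dom k xy.1 /\ xy.2 = d xy.1];
  d_dom : forall k (x : hspace k), @dom k x -> @dom (k + 1) (d x);
  dd0 : forall k (x : hspace k), @dom k x -> d (d x) = 0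
}.
Arguments dom {R} W k : rename.
Arguments d {R W k} x : rename.

Section Complex.
Context {R : realType} {W : hilbert_complex R}.
Implicit Types k : int.

Definition innerV k (u v : W k) : R := inner u v + inner (d u) (d v).
Definition normV k (u : W k) : R := Num.sqrt (innerV u u).

Definition distV k (x : W k) (S : set (W k)) : R :=
  inf [set normV (x - y) | y in S].

Definition cocycles k : set (W k) := [set u | dom W k u /\ d u = 0].

(* The images of degree k + 1: since the degree of [d x] is [k + 1], the      *)
(* coboundaries and the harmonic forms of degree [k + 1] are indexed by [k].  *)
Definition coboundaries k : set (W (k + 1)) := d @` dom W k.
Definition harmonics k : set (W (k + 1)) :=
  [set u | cocycles u /\ forall b, coboundaries b -> inner u b = 0].

Definition closed_complex : Prop := forall k, closed (@coboundaries k).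

Definition monotone_op k (F : W k -> W k) : Prop :=
  forall u v, dom W k u -> dom W k v -> 0 <= inner (F u - F v) (u - v).

Definition hemicontinuous k (F : W k -> W k) : Prop :=
  forall u v w : W k, dom W k u -> dom W k v ->
    {within `[0, 1], continuous (fun t : R => inner (F (u + t *: v)) w : R)}.

(* [l] plays the role of k - 1, and [l + 1] that of k. *)
Definition mixed_solution (l : int) (F : W (l + 1) -> W (l + 1))
    (f : W (l + 1)) (sigma : W l) (u p : W (l + 1)) : Prop :=
  [/\ dom W l sigma, dom W (l + 1) u, harmonics p &
   [/\ forall tau, dom W l tau -> inner sigma tau - inner u (d tau) = 0,
       forall v, dom W (l + 1) v ->
         inner (d sigma) v + inner (d u) (d v) + inner p v + inner (F (u + p)) v
         = inner f v &
       forall q, harmonics q -> inner u q = 0]].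

End Complex.
Arguments closed_complex {R} W.
Arguments coboundaries {R} W k.
Arguments harmonics {R} W k.

Definition is_morphism (R : realType) (W W' : hilbert_complex R)
    (m : forall k : int, W k -> W' k) : Prop :=
  forall k : int,
    [/\ forall (a : R) (x y : W k), dom W k x -> dom W k y ->
          m k (a *: x + y) = a *: m k x + m k y,
        forall x, dom W k x -> dom W' k (m k x) &
        forall x, dom W k x -> m (k + 1) (d x) = d (m k x)].

(* Projection of [x] onto the subspace [S], orthogonal for the form [b].  The *)
(* default value 0 is taken only if there is no such projection.              *)
Definition oproj (R : realType) (E : hilbertType R) (b : E -> E -> R)
    (S : set E) (x : E) : E :=
  xget 0 [set y | S y /\ forall z, S z -> b (x - y) z = 0].

Definition adjoint (R : realType) (E E' : hilbertType R) (T : E -> E')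
    (y : E') : E :=
  xget 0 [set x | forall z, inner z x = inner (T z) y].

Definition opnorm (R : realType) (E E' : hilbertType R) (T : E -> E') : R :=
  sup [set `|T x| | x in [set x | `|x| <= 1]].

(* As i is W-bounded and its domain is dense, it extends to the whole of W_h; *)
(* [i] is this extension.  Only the restriction of [pi] to V is meaningful.   *)
Section DiscreteComplex.
Context {R : realType} {W Wh : hilbert_complex R}.
Variables (i : forall k : int, {linear Wh k -> W k}).
Variables (pi : forall k : int, W k -> Wh k).

(* P_{V_h}: the preimage under i of the V-orthogonal projection onto i V_h. *)
Definition projVh (k : int) (v : W k) : Wh k :=
  xget 0 [set vh | dom Wh k vh /\
                   i k vh = oproj (@innerV R W k) (i k @` dom Wh k) v].

Definition J (k : int) (x : Wh k) : Wh k := adjoint (i k) (i k x).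

Definition defectJ (k : int) : R := opnorm (fun x : Wh k => x - J x).

(* The supremum in degree l + 1; it is [sup set0 = 0] when the harmonic space *)
(* is trivial.                                                                *)
Definition harmonic_gap (l : int) : R :=
  sup [set `|r - i (l + 1) (pi r)|
      | r in [set r | harmonics W l r /\ `|r| = 1]].

End DiscreteComplex.

(* Main.v *)
(* The discrete solution is compared with V-best approximations of sigma and  *)
(* u and with the discrete harmonic part of pi p.  The differences solve the  *)
(* discrete mixed problem up to residuals.  Each residual turns into best     *)
(* approximation errors plus terms <x, y>_h - <i x, i y>, which are bounded   *)
(* by |I - J|.  Testing with the differences themselves, monotonicity of F_h  *)
(* absorbs the nonlinear term at P_{V_h}(u + p), the Lipschitz bound controls *)
(* what remains, and a quadratic inequality closes the estimate.              *)
(*                                                                            *)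
(* Stability rests on the Poincare inequality |v| <= c |d v| for v orthogonal *)
(* to the cocycles, which for a complex with closed range follows from the    *)
(* uniform boundedness principle, and which pi_h and i_h carry over to the    *)
(* discrete complexes with a constant independent of h.                       *)
(*                                                                            *)
(* The factor mu appears because u is orthogonal to the harmonic forms: for a *)
(* discrete harmonic form q, <u, i q> only sees the component of i q in the   *)
(* coboundaries, of size O(mu + |I - J|), paired with P_B u - i pi P_B u.     *)

Require Import Defs.
From HB Require Import structures.
From mathcomp Require Import all_boot all_order all_algebra.
From mathcomp Require Import sesquilinear.
From mathcomp Require Import all_classical all_reals all_analysis.
From mathcomp Require Import ring lra.

Set Implicit Arguments.
Unset Strict Implicit.
Unset Printing Implicit Defensive.

Import Order.TTheory GRing.Theory Num.Theory.
Import numFieldNormedType.Exports.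

Local Open Scope classical_set_scope.
Local Open Scope ring_scope.

(** * Scalar products and the Riesz lemma *)

(** Each error is a best approximation error minus i_h of a discrete difference: s = sigma_h - [s0],
    e = u_h - [v0], r = p_h - q, where [s0], [v0] are V-projections ([projVhP]) and q is a discrete
    harmonic form close to p ([harmonic_approx]). These differences solve the discrete mixed problem
    up to residuals bounded by the right-hand side of the theorem, with nonlinear term delta =
    F_h(P_{V_h}(u+p)) - F_h(u_h+p_h).

    [energy_estimate] turns residuals into bounds. Testing controls |s|^2 + |d e|^2 + |r|^2;
    monotonicity gives the pairing of delta with e + r the right sign up to a small term, and the
    Lipschitz bound controls |delta|. The norm of e itself comes from [stability], that is, from the
    Hodge decomposition and the Poincare inequality, and [quadratic_bound] closes the argument.

    Uniformity in h comes from [poincare_closed] on W, carried over by [poincare_discrete].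
    Projections onto discrete coboundaries are then obtained from the Poincare inequality
    ([coboundary_projection]).

    Exchanging the two scalar products costs |I - J| times norms of the solution ([inner_defect]),
    and [mixed_solution_bound] bounds those norms by |f - F(u+p)|; this produces the last term. The
    term with mu comes from [harmonic_coboundary] and [harmonic_residual]. *)

Section InnerProduct.
Context {R : realType} {E : hilbertType R}.
Implicit Types x y z : E.

Lemma innerC x y : inner x y = inner y x.
Proof. by rewrite hermC expr0 mul1r. Qed.

Lemma innerDl x y z : inner (x + y) z = inner x z + inner y z.
Proof. exact: linearDl. Qed.

Lemma innerDr x y z : inner x (y + z) = inner x y + inner x z.
Proof. exact: linearDr. Qed.

Lemma innerZl (a : R) x y : inner (a *: x) y = a * inner x y.
Proof. exact: linearZl_LR. Qed.

Lemma innerZr (a : R) x y : inner x (a *: y) = a * inner x y.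
Proof. exact: linearZr_LR. Qed.

Lemma innerNl x y : inner (- x) y = - inner x y.
Proof. exact: linearNl. Qed.

Lemma innerNr x y : inner x (- y) = - inner x y.
Proof. exact: linearNr. Qed.

Lemma innerBl x y z : inner (x - y) z = inner x z - inner y z.
Proof. exact: linearBl. Qed.

Lemma innerBr x y z : inner x (y - z) = inner x y - inner x z.
Proof. exact: linearBr. Qed.

Lemma inner0l x : inner 0 x = 0.
Proof. exact: linear0l. Qed.

Lemma inner0r x : inner x 0 = 0.
Proof. exact: linear0r. Qed.

Lemma inner_ge0 x : 0 <= inner x x.
Proof. by rewrite inner_norm sqr_ge0. Qed.

Lemma inner_eq0 x : inner x x = 0 -> x = 0.
Proof. by rewrite inner_norm => /eqP; rewrite sqrf_eq0 normr_eq0 => /eqP. Qed.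

Lemma cauchy_schwarz x y : `|inner x y| <= `|x| * `|y|.
Proof.
have [->|y0] := eqVneq y 0; first by rewrite inner0r !normr0 mulr0.
have ny : 0 < `|y| by rewrite normr_gt0.
rewrite -(@ler_pXn2r _ 2) ?nnegrE ?mulr_ge0// -normrX ger0_norm ?sqr_ge0//.
rewrite exprMn.
have := inner_ge0 (`|y| ^+ 2 *: x - inner x y *: y).
rewrite innerBl !innerBr !innerZl !innerZr !inner_norm (innerC y x).
set a := `|x|; set b := `|y|; set t := inner x y.
rewrite [X in 0 <= X](_ : _ = b ^+ 2 * (a ^+ 2 * b ^+ 2 - t ^+ 2)); last by ring.
by rewrite pmulr_rge0 ?exprn_gt0// subr_ge0.
Qed.

Lemma inner_le x y : inner x y <= `|x| * `|y|.
Proof. exact: le_trans (ler_norm _) (cauchy_schwarz x y). Qed.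

(** Cancels one factor of the norm after an equation has been tested with the unknown itself. *)
Lemma norm_le_of_inner x (a : R) : 0 <= a -> inner x x <= a * `|x| -> `|x| <= a.
Proof.
have [->|x0 _] := eqVneq x 0; first by rewrite normr0.
by rewrite inner_norm expr2 ler_pM2r ?normr_gt0.
Qed.

End InnerProduct.

(** * Completeness and Riesz representation for a form on a subspace *)

Section Complete.
Context {R : realType}.

(* [q] is the quadratic form of a scalar product on a subspace only: [d] is   *)
(* linear on its domain, not on the whole space.                              *)
Definition cauchy_for {E : zmodType} (q : E -> R) (s : nat -> E) :=
  forall e, 0 < e -> exists N, forall n m, (N <= n)%N -> (N <= m)%N ->
    q (s n - s m) <= e.

Definition cvg_for {E : zmodType} (q : E -> R) (s : nat -> E) (x : E) :=
  forall e, 0 < e -> exists N, forall n, (N <= n)%N -> q (s n - x) <= e.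

Definition complete_for {E : zmodType} (D : set E) (q : E -> R) :=
  forall s, (forall n, D (s n)) -> cauchy_for q s ->
  exists2 x, D x & cvg_for q s x.

Definition linsub {E : lmodType R} (D : set E) :=
  D 0 /\ forall (a : R) x y, D x -> D y -> D (a *: x + y).

Lemma linsubD {E : lmodType R} (D : set E) x y : linsub D ->
  D x -> D y -> D (x + y).
Proof. by move=> [_ Dl] Dx Dy; rewrite -(scale1r x); apply: Dl. Qed.

Lemma linsubZ {E : lmodType R} (D : set E) (a : R) x : linsub D ->
  D x -> D (a *: x).
Proof. by move=> [D0 Dl] Dx; rewrite -(addr0 (a *: x)); apply: Dl. Qed.

Lemma linsubB {E : lmodType R} (D : set E) x y : linsub D ->
  D x -> D y -> D (x - y).
Proof.
move=> Ds Dx Dy; rewrite -scaleN1r.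
by apply: linsubD => //; exact: linsubZ.
Qed.

Lemma cauchy_for_sub {E : lmodType R} (D : set E) (q q' : E -> R) (K : R) s :
  linsub D -> 0 < K -> (forall x, D x -> q' x <= K * q x) ->
  (forall n, D (s n)) -> cauchy_for q s -> cauchy_for q' s.
Proof.
move=> Ds K0 qq Ss cs e e0.
have [|N HN] := cs (e / K); first by rewrite divr_gt0.
exists N => n m Nn Nm; apply: le_trans (qq _ (linsubB Ds (Ss n) (Ss m))) _.
by rewrite mulrC -ler_pdivlMr// HN.
Qed.

Lemma complete_equiv {E : lmodType R} (D : set E) (q q' : E -> R) (K : R) :
  linsub D -> 0 < K -> (forall x, D x -> q x <= K * q' x) ->
  (forall x, D x -> q' x <= K * q x) -> complete_for D q -> complete_for D q'.
Proof.
move=> Ds K0 qq' q'q cq s Ss cs.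
have [x Dx sx] := cq s Ss (cauchy_for_sub Ds K0 qq' Ss cs).
exists x => // e e0; have [|N HN] := sx (e / K); first by rewrite divr_gt0.
exists N => n Nn; apply: le_trans (q'q _ (linsubB Ds (Ss n) Dx)) _.
by rewrite mulrC -ler_pdivlMr// HN.
Qed.

Lemma cauchy_lim {E : completeNormedModType R} (s : nat -> E) :
  cauchy_for (fun x => `|x| ^+ 2) s -> exists x : E, s @ \oo --> x.
Proof.
move=> cs; suff /cauchy_cvgP sc : cauchy (s @ \oo) by exists (lim (s @ \oo)).
apply: cauchy_exP => e e0.
have [|N HN] := cs ((e / 2) ^+ 2); first by rewrite exprn_gt0 ?divr_gt0.
exists (s N); exists N => // n /= Nn.
rewrite -ball_normE/=; have := HN N n (leqnn _) Nn.
rewrite ler_pXn2r ?nnegrE ?divr_ge0 ?(ltW e0)// => /le_lt_trans; apply.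
by lra.
Qed.

Lemma cvg_for_norm {E : completeNormedModType R} (s : nat -> E) (x : E) :
  s @ \oo --> x -> cvg_for (fun x => `|x| ^+ 2) s x.
Proof.
move=> /cvgrPdist_le sx e e0.
have [|N _ HN] := sx (Num.sqrt e); first by rewrite sqrtr_gt0.
exists N => n /HN; rewrite distrC -(@ler_pXn2r _ 2) ?nnegrE ?sqrtr_ge0//.
by rewrite sqr_sqrtr// ltW.
Qed.

Lemma complete_closed {E : completeNormedModType R} (D : set E) :
  closed D -> complete_for D (fun x => `|x| ^+ 2).
Proof.
move=> Dc s Ds /cauchy_lim[x sx]; exists x; last exact: cvg_for_norm.
by apply: (closed_cvg D Dc _ _ sx); near=> n; exact: Ds.
Unshelve. all: by end_near. Qed.

Lemma inv_small (e : R) : 0 < e ->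
  exists N, forall n, (N <= n)%N -> n.+1%:R^-1 <= e.
Proof.
move=> e0; have [N _ HN] := near_infty_natSinv_lt (PosNum e0).
by exists N => n /HN /ltW.
Qed.

Section Riesz.
Context {E : lmodType R}.
Variables (D : set E) (b : E -> E -> R) (L : E -> R) (c : R).
Hypotheses (Ds : linsub D) (bC : forall x y, D x -> D y -> b x y = b y x).
Hypothesis blin : forall (a : R) x y z, D x -> D y -> D z ->
  b (a *: x + y) z = a * b x z + b y z.
Hypothesis b_ge0 : forall x, D x -> 0 <= b x x.
Hypothesis b_complete : complete_for D (fun x => b x x).
Hypothesis Llin : forall (a : R) x y, D x -> D y -> L (a *: x + y) = a * L x + L y.
Hypothesis c_gt0 : 0 < c.
Hypothesis L_bounded : forall x, D x -> L x ^+ 2 <= c * b x x.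

Let q x := b x x - 2 * L x.

Let bsq a x y : D x -> D y ->
  b (a *: x + y) (a *: x + y) = a ^+ 2 * b x x + 2 * a * b x y + b y y.
Proof.
move=> Dx Dy; have Dxy := Ds.2 a _ _ Dx Dy.
rewrite blin// !(bC _ Dxy)// !blin// (bC Dy Dx); ring.
Qed.

Let b_cs x y : D x -> D y -> b x y ^+ 2 <= b x x * b y y.
Proof.
move=> Dx Dy; have [y0|y0] := eqVneq (b y y) 0.
  suff -> : b x y = 0 by rewrite y0 expr0n mulr0.
  apply/eqP/negPn/negP => xy0.
  (* [b] is only semidefinite, so [b y y = 0] does not give [y = 0]. With this coefficient the form
     would take the value -1 at a combination of [y] and [x]. *)
  have := b_ge0 (Ds.2 (- (b x x + 1) / (2 * b x y)) _ _ Dy Dx).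
  rewrite bsq// y0 (bC Dy Dx).
  set a := b x x; set t := b x y in xy0 *.
  rewrite [X in 0 <= X](_ : _ = -1); last by field.
  by rewrite ler0N1.
have y1 : 0 < b y y by rewrite lt_def y0 b_ge0.
have := b_ge0 (Ds.2 (- (b x y / b y y)) _ _ Dy Dx).
rewrite bsq// (bC Dy Dx).
rewrite [X in 0 <= X](_ : _ = (b x x * b y y - b x y ^+ 2) / b y y); last by field.
by rewrite pmulr_lge0 ?invr_gt0// subr_ge0.
Qed.

(* The solution minimizes [b x x - 2 L x]; by the parallelogram identity any  *)
(* minimizing sequence is Cauchy.                                             *)
Lemma riesz : exists2 x, D x & forall z, D z -> b x z = L z.
Proof.
set A := [set q x | x in D].
(* Completing the square: c * q x >= (L x)^2 - 2 c L x >= - c^2. *)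
have q_ge x : D x -> - c <= q x.
  move=> Dx; rewrite /q; have := L_bounded Dx; have := sqr_ge0 (L x - c).
  move: (L x) (b x x) => t a t1 t2.
  suff : c * (a - 2 * t) >= c * (- c) by rewrite ler_pM2l.
  nra.
have A_inf : has_inf A.
  split; first by exists (q 0), 0 => //; exact: Ds.1.
  by exists (- c) => _ [x Dx <-]; exact: q_ge.
have q_min x : D x -> inf A <= q x.
  by move=> Dx; apply: ge_inf; [exact: A_inf.2 | exists x].
have /choice[s sP] (n : nat) : exists x, D x /\ q x <= inf A + n.+1%:R^-1.
  have n0 : 0 < n.+1%:R^-1 :> R by rewrite invr_gt0 ltr0n.
  by have [_ [x Dx <-] /ltW ?] := inf_adherent n0 A_inf; exists x.
have parallelogram x y : D x -> D y ->
    b (x - y) (x - y) = 2 * q x + 2 * q y - 4 * q (2^-1 *: x + 2^-1 *: y).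
  move=> Dx Dy; have Dy2 := linsubZ 2^-1 Ds Dy.
  have D0 := Ds.1.
  have bz z w : D z -> D w -> b (2^-1 *: z) w = 2^-1 * b z w.
    move=> Dz Dw; have := blin (-1) D0 D0 Dw.
    rewrite scaler0 addr0 mulN1r addNr => b0.
    by rewrite -[2^-1 *: z]addr0 blin// b0 addr0.
  have Lz z : D z -> L (2^-1 *: z) = 2^-1 * L z.
    move=> Dz; have := Llin (-1) D0 D0.
    rewrite scaler0 addr0 mulN1r addNr => L0.
    by rewrite -[2^-1 *: z]addr0 Llin// L0 addr0.
  rewrite addrC -scaleN1r bsq// /q bsq// Llin// Lz//.
  rewrite (bC Dx Dy2) bz// bz// (bC Dy Dy2) bz// (bC Dy Dx).
  by field.
have cs : cauchy_for (fun x => b x x) s.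
  move=> e e0; have [|N inv_le] := @inv_small (e / 4); first by rewrite divr_gt0.
  exists N => n m Nn Nm.
  have [[Dn qn] [Dm qm]] := (sP n, sP m).
  rewrite parallelogram//.
  have := q_min _ (linsubD Ds (linsubZ 2^-1 Ds Dn) (linsubZ 2^-1 Ds Dm)).
  move: (inv_le _ Nn) (inv_le _ Nm) qn qm; move: (q _) (q _) (q _) => ? ? ?.
  by move: n.+1%:R^-1 m.+1%:R^-1 => ? ?; lra.
have [x Dx sx] := b_complete (fun n => (sP n).1) cs.
exists x => // z Dz.
set B := b z z; have B0 : 0 <= B by exact: b_ge0.
have B1 : 0 < B + 1 by rewrite ltr_pwDr.
(* The value of [q] at the limit is not computed. Near-minimality of [s n] makes its residual in
   direction [z] small, and Cauchy-Schwarz passes this on to [x]. *)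
have approx e : 0 < e -> (b x z - L z) ^+ 2 <= 4 * (e * (B + 1)).
  move=> e0; have [N HN] := sx _ e0.
  have [M HM] := inv_small e0; pose n := maxn N M.
  have ne : n.+1%:R^-1 <= e :> R by rewrite HM// leq_maxr.
  have [Dn qn] := sP n.
  have := HN n (leq_maxl _ _) => xn.
  have Dnx := linsubB Ds Dn Dx.
  have h1 : (b (s n) z - b x z) ^+ 2 <= e * B.
    have <- : b (s n - x) z = b (s n) z - b x z.
      by rewrite addrC -scaleN1r blin// mulN1r addrC.
    by apply: le_trans (b_cs Dnx Dz) _; rewrite ler_wpM2r.
  have h2 : (b (s n) z - L z) ^+ 2 <= e * (B + 1).
    set w := b (s n) z - L z.
    (* The optimal step along [z] is - w / B; the added 1 covers [B = 0]. *)
    have := q_min _ (Ds.2 (- w / (B + 1)) _ _ Dz Dn).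
    rewrite /q bsq// Llin// -/B (bC Dz Dn) => h.
    have {h} : - e <= 2 * (- w / (B + 1)) * w + (- w / (B + 1)) ^+ 2 * B.
      move: h qn ne; rewrite /q /B; move: (- w / _) => t; rewrite /w.
      move: (b z z) (b (s n) z) (b (s n) (s n)) (L z) (L (s n)) => a1 a2 a3 a4 a5.
      by move: n.+1%:R^-1 (inf A) => a6 a7; lra.
    rewrite [X in _ <= X](_ : _ = - (w ^+ 2 * (B + 2) / (B + 1) ^+ 2)); last first.
      by field; rewrite gt_eqF.
    rewrite lerN2 ler_pdivrMr ?exprn_gt0// => h.
    have : w ^+ 2 * (B + 1) <= e * (B + 1) * (B + 1).
      by apply: le_trans (_ : _ <= w ^+ 2 * (B + 2)) _;
        [rewrite ler_wpM2l ?sqr_ge0//; lra | rewrite -mulrA -expr2].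
    by rewrite ler_pM2r.
  have : (b x z - L z) ^+ 2 <=
      2 * (b (s n) z - b x z) ^+ 2 + 2 * (b (s n) z - L z) ^+ 2.
    have := sqr_ge0 (2 * b (s n) z - b x z - L z); lra.
  lra.
apply/eqP; rewrite -subr_eq0 -sqrf_eq0 eq_le sqr_ge0 andbT leNgt.
apply/negP => v0.
have := approx ((b x z - L z) ^+ 2 / (8 * (B + 1))).
move=> /(_ (divr_gt0 v0 (mulr_gt0 _ B1))) => /(_ (ltr0n _ 8)).
rewrite [X in _ <= X](_ : _ = (b x z - L z) ^+ 2 / 2); first by lra.
by field; rewrite gt_eqF.
Qed.
End Riesz.
End Complete.

(** * Domains of a Hilbert complex *)

Section Domain.
Context {R : realType} {W : hilbert_complex R}.
Implicit Types k : int.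

Lemma linsub_dom k : linsub (dom W k).
Proof. exact: conj (@dom0 _ W k) (@dom_lin _ W k). Qed.

Lemma domD k (x y : W k) : dom W k x -> dom W k y -> dom W k (x + y).
Proof. exact: (linsubD (linsub_dom k)). Qed.

Lemma domB k (x y : W k) : dom W k x -> dom W k y -> dom W k (x - y).
Proof. exact: (linsubB (linsub_dom k)). Qed.

Lemma dD k (x y : W k) : dom W k x -> dom W k y -> d (x + y) = d x + d y.
Proof. by move=> Dx Dy; rewrite -[x in LHS]scale1r d_lin// scale1r. Qed.

Lemma d0 k : d (0 : W k) = 0.
Proof.
have := dD (@dom0 _ W k) (@dom0 _ W k); rewrite addr0 => /esym/eqP.
by rewrite -subr_eq0 addrK => /eqP.
Qed.

Lemma dZ k (a : R) (x : W k) : dom W k x -> d (a *: x) = a *: d x.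
Proof. by move=> Dx; rewrite -[a *: x]addr0 d_lin ?d0 ?addr0//; exact: dom0. Qed.

Lemma dB k (x y : W k) : dom W k x -> dom W k y -> d (x - y) = d x - d y.
Proof.
by move=> Dx Dy; rewrite [x - y]addrC -scaleN1r d_lin// scaleN1r [RHS]addrC.
Qed.

Lemma innerVC k (x y : W k) : innerV x y = innerV y x.
Proof. by rewrite /innerV innerC [X in _ + X]innerC. Qed.

Lemma innerV_lin k (a : R) (x y z : W k) : dom W k x -> dom W k y ->
  innerV (a *: x + y) z = a * innerV x z + innerV y z.
Proof.
move=> Dx Dy; rewrite /innerV d_lin// !innerDl !innerZl; ring.
Qed.

Lemma innerVE k (x : W k) : innerV x x = `|x| ^+ 2 + `|d x| ^+ 2.
Proof. by rewrite /innerV !inner_norm. Qed.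

Lemma innerV_ge0 k (x : W k) : 0 <= innerV x x.
Proof. by rewrite innerVE addr_ge0 ?sqr_ge0. Qed.

Lemma normV_ge0 k (x : W k) : 0 <= normV x.
Proof. exact: sqrtr_ge0. Qed.

Lemma sqr_normV k (x : W k) : normV x ^+ 2 = innerV x x.
Proof. by rewrite /normV sqr_sqrtr// innerV_ge0. Qed.

Lemma norm_le_normV k (x : W k) : `|x| <= normV x.
Proof.
rewrite -(@ler_pXn2r _ 2) ?nnegrE ?normV_ge0// sqr_normV innerVE.
by rewrite lerDl sqr_ge0.
Qed.

Lemma normd_le_normV k (x : W k) : `|d x| <= normV x.
Proof.
rewrite -(@ler_pXn2r _ 2) ?nnegrE ?normV_ge0// sqr_normV innerVE.
by rewrite lerDr sqr_ge0.
Qed.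

Lemma normV_le k (x : W k) : normV x <= `|x| + `|d x|.
Proof.
rewrite -(@ler_pXn2r _ 2) ?nnegrE ?normV_ge0 ?addr_ge0// sqr_normV innerVE.
rewrite sqrrD lerD2r lerDl mulrn_wge0// mulr_ge0//.
Qed.

Lemma linsub_cocycles k : linsub (@cocycles R W k).
Proof.
rewrite /linsub; split; first by split; [exact: dom0 | exact: d0].
by move=> a x y [Dx x0] [Dy y0]; split; [exact: dom_lin |
  rewrite d_lin// x0 y0 scaler0 addr0].
Qed.

Lemma cocycles_d k (x : W k) : dom W k x -> cocycles (d x).
Proof. by move=> Dx; split; [exact: d_dom | exact: dd0]. Qed.

Lemma coboundaries_cocycles k (b : W (k + 1)) : coboundaries W k b -> cocycles b.
Proof. by move=> [x Dx <-]; exact: cocycles_d. Qed.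

Lemma linsub_coboundaries k : linsub (coboundaries W k).
Proof.
rewrite /linsub; split; first by exists 0; [exact: dom0 | exact: d0].
move=> a _ _ [x Dx <-] [y Dy <-]; exists (a *: x + y); first exact: dom_lin.
by rewrite d_lin.
Qed.

Lemma graph_lim k (s : nat -> W k) (x : W k) (y : W (k + 1)) :
  (forall n, dom W k (s n)) -> s @ \oo --> x -> (fun n => d (s n)) @ \oo --> y ->
  dom W k x /\ y = d x.
Proof.
move=> Ds sx sy.
pose G := [set xy : (W k * W (k + 1)%R)%type | dom W k xy.1 /\ xy.2 = d xy.1].
have sxy : (fun n => (s n, d (s n))) @ \oo --> (x, y) by exact: cvg_pair.
suff : G (x, y) by [].
by apply: (closed_cvg G (@d_closed _ W k) _ _ sxy); near=> n; split => //; exact: Ds.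
Unshelve. all: by end_near. Qed.

(** A sequence that is Cauchy in the graph norm converges together with its images, and the closed
    graph of [d] matches the two limits. This makes Riesz representation available on the domain. *)
Lemma complete_dom k : complete_for (dom W k) (fun x => innerV x x).
Proof.
move=> s Ds cs.
have [x sx] : exists x : W k, s @ \oo --> x.
  apply: cauchy_lim => e e0; have [N HN] := cs e e0.
  exists N => n m Nn Nm; apply: le_trans (HN n m Nn Nm).
  by rewrite innerVE lerDl sqr_ge0.
have [y sy] : exists y : W (k + 1), (fun n => d (s n)) @ \oo --> y.
  apply: cauchy_lim => e e0; have [N HN] := cs e e0.
  exists N => n m Nn Nm; apply: le_trans (HN n m Nn Nm).
  by rewrite innerVE -dB// lerDr sqr_ge0.
have [Dx yE] := graph_lim Ds sx sy.
exists x => // e e0.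
have e2 : 0 < e / 2 by rewrite divr_gt0.
have [N1 H1] := cvg_for_norm sx e2.
have [N2 H2] := cvg_for_norm sy e2.
exists (maxn N1 N2) => n; rewrite geq_max => /andP[/H1 h1 /H2].
by rewrite innerVE yE -dB//= => h2; lra.
Qed.

Lemma closed_cocycles k : closed (@cocycles R W k).
Proof.
pose G := [set xy : (W k * W (k + 1)%R)%type | dom W k xy.1 /\ xy.2 = d xy.1].
have -> : @cocycles R W k = (fun x => (x, 0)) @^-1` G.
  by apply/seteqP; split => x /= [Dx /esym].
apply: (preimage_closed _ (@d_closed _ W k)) => x _.
by apply: cvg_pair; [exact: cvg_id | exact: cvg_cst].
Qed.

End Domain.

(** * Projections and Poincare inequality *)

Section Projections.
Context {R : realType} {E : hilbertType R}.

Lemma sqr_inner_le (x y : E) : inner x y ^+ 2 <= `|x| ^+ 2 * `|y| ^+ 2.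
Proof.
rewrite -[leLHS]real_normK ?num_real// -exprMn.
by rewrite ler_pXn2r ?nnegrE ?mulr_ge0// cauchy_schwarz.
Qed.

Lemma riesz_complete (D : set E) (L : E -> R) (c : R) :
  linsub D -> complete_for D (fun x => `|x| ^+ 2) -> 0 < c ->
  (forall (a : R) x y, D x -> D y -> L (a *: x + y) = a * L x + L y) ->
  (forall x, D x -> L x ^+ 2 <= c * `|x| ^+ 2) ->
  exists2 x, D x & forall z, D z -> inner x z = L z.
Proof.
move=> Ds Dc c0 Ll Lc.
apply: (@riesz _ E D inner L c) => //.
- by move=> x y _ _; exact: innerC.
- by move=> a x y z _ _ _; rewrite innerDl innerZl.
- by move=> x _; exact: inner_ge0.
- suff -> : (fun x : E => inner x x) = (fun x => `|x| ^+ 2) by [].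
  by apply/funext => x; exact: inner_norm.
- by move=> x Dx; rewrite inner_norm; exact: Lc.
Qed.

Lemma projection (D : set E) (x : E) :
  linsub D -> complete_for D (fun x => `|x| ^+ 2) ->
  exists2 y, D y & forall z, D z -> inner (x - y) z = 0.
Proof.
move=> Ds Dc.
have [||z Dz|y Dy yP] := @riesz_complete D (inner x) (`|x| ^+ 2 + 1) Ds Dc.
- by rewrite ltr_wpDl// sqr_ge0.
- by move=> a y z _ _; rewrite innerDr innerZr.
- apply: le_trans (sqr_inner_le _ _) _.
  by rewrite ler_wpM2r ?sqr_ge0// lerDl.
by exists y => // z Dz; rewrite innerBl yP// subrr.
Qed.

End Projections.

(** Boundedness of [T] makes the functional z -> <T z, y> representable, so [adjoint] does not fall
    back on its default 0. *)
Lemma adjointP (R : realType) (E E' : hilbertType R) (T : {linear E -> E'})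
  (c : R) (y : E') : (forall x, `|T x| <= c * `|x|) ->
  forall z, inner z (adjoint T y) = inner (T z) y.
Proof.
move=> Tc.
have Ts : linsub [set: E] by [].
have Tcl : complete_for [set: E] (fun x => `|x| ^+ 2).
  by apply: complete_closed; exact: closedT.
have [||x _|x _ xP] := @riesz_complete _ _ setT (fun z => inner (T z) y)
  (c ^+ 2 * `|y| ^+ 2 + 1) Ts Tcl.
- by rewrite ltr_wpDl// mulr_ge0// sqr_ge0.
- by move=> a u v _ _; rewrite linearP innerDl innerZl.
- apply: le_trans (sqr_inner_le _ _) _.
  apply: le_trans (_ : (c * `|x|) ^+ 2 * `|y| ^+ 2 <= _).
    rewrite ler_wpM2r ?sqr_ge0// ler_pXn2r ?nnegrE//.
    by rewrite (le_trans _ (Tc x)).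
  have := sqr_ge0 `|x|; rewrite exprMn; lra.
rewrite /adjoint; case: xgetP => [x' -> //|/(_ x)]; case.
by move=> z; rewrite innerC xP.
Qed.

Section Poincare.
Context {R : realType}.

Lemma sqr_small (a K : R) : (forall e, 0 < e -> a ^+ 2 <= K * e) -> a = 0.
Proof.
move=> h; apply/eqP; rewrite -sqrf_eq0 eq_le sqr_ge0 andbT leNgt.
apply/negP => a0; have K1 : 0 < `|K| + 1 by rewrite ltr_pwDr.
have e0 : 0 < a ^+ 2 / (2 * (`|K| + 1)) by rewrite divr_gt0// mulr_gt0.
have := h _ e0; have : K * (a ^+ 2 / (2 * (`|K| + 1))) <=
    (`|K| + 1) * (a ^+ 2 / (2 * (`|K| + 1))).
  by rewrite ler_wpM2r ?(ltW e0)//; have := ler_norm K; lra.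
rewrite [X in _ <= X](_ : _ = a ^+ 2 / 2); first by lra.
by field; rewrite gt_eqF.
Qed.

Definition poincare (W : hilbert_complex R) (k : int) (c : R) :=
  forall v : W k, dom W k v -> (forall z, cocycles z -> inner v z = 0) ->
    `|v| <= c * `|d v|.

Context {W : hilbert_complex R}.
Variable k : int.

(** The weak solution of x + d^* d x = m. *)
Lemma riesz_dom (m : W k) :
  exists2 x, dom W k x & forall v, dom W k v -> innerV x v = inner m v.
Proof.
apply: (@riesz _ _ (dom W k) (@innerV R W k) (inner m) (`|m| ^+ 2 + 1)).
- exact: linsub_dom.
- by move=> x y _ _; exact: innerVC.
- by move=> a x y z Dx Dy _; exact: innerV_lin.
- by move=> x _; exact: innerV_ge0.
- exact: complete_dom.
- by move=> a y z _ _; rewrite innerDr innerZr.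
- by rewrite ltr_wpDl// sqr_ge0.
- move=> x _; apply: le_trans (sqr_inner_le _ _) _.
  apply: ler_pM; rewrite ?sqr_ge0// ?lerDl//.
  by rewrite innerVE lerDl sqr_ge0.
Qed.

(* [y] is a coboundary in the domain of the adjoint of [d], with value [w].   *)
Let dadj (y : W (k + 1)) (w : W k) :=
  coboundaries W k y /\ forall v, dom W k v -> inner y (d v) = inner w v.

(* Uniform boundedness of the functionals [inner ^~ y], where [y] ranges over *)
(* the coboundaries with [`|d^* y| <= 1]: if the component of [x] in the      *)
(* closed space of coboundaries is [d z], then [<x, y> = <z, d^* y>].         *)
Lemma poincare_dadj : closed (coboundaries W k) ->
  exists2 c, 0 < c & forall y w, dadj y w -> `|y| <= c * `|w|.
Proof.
move=> Bcl.
pose Fam : set (W (k + 1) -> R^o) := [set f | exists y w,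
  [/\ dadj y w, `|w| <= 1 & f = fun x => inner x y]].
have [|x|M HM] := @Banach_Steinhauss R (W (k + 1)) R^o Fam _ _ 1.
- move=> _ [y [w [_ _ ->]]]; split.
    move=> r; exists (r * `|y|) => x xr.
    by apply: le_trans (cauchy_schwarz _ _) _; rewrite ler_wpM2r.
  by move=> a x x'; rewrite innerDl innerZl.
- have [_ [z Dz <-] xP] := projection x (linsub_coboundaries k) (complete_closed Bcl).
  exists `|z| => _ [y [w [[By wP] w1 ->]]].
  rewrite -[x](subrK (d z)) innerDl xP// add0r innerC wP//.
  by apply: le_trans (cauchy_schwarz _ _) _; rewrite ler_piMl.
have bound y w : dadj y w -> `|w| <= 1 -> `|y| <= `|M| + 1.
  move=> yw w1; have [->|y0] := eqVneq y 0; first by rewrite normr0 addr_ge0.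
  have := HM (fun x => inner x y) (ex_intro _ y (ex_intro _ w (And3 yw w1 erefl)))
    (`|y|^-1 *: y).
  rewrite normrZ normfV normr_id mulVf ?normr_eq0// => /(_ (lexx _)).
  rewrite innerZl inner_norm expr2 mulKf ?normr_eq0// normr_id => h.
  apply: (le_trans h); have := ler_norm M; lra.
exists (`|M| + 1); first by rewrite ltr_pwDr.
(* For [w = 0] there is nothing to normalize by; then y = d v is orthogonal to itself. *)
move=> y w [By yw]; have [w0|w0] := eqVneq w 0.
  suff -> : y = 0 by rewrite normr0 mulr_ge0 ?addr_ge0.
  case: By => v Dv vy; apply: inner_eq0.
  by rewrite -{2}vy yw// w0 inner0l.
have nw : 0 < `|w| by rewrite normr_gt0.
have : `|(`|w|^-1 *: y)| <= `|M| + 1.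
  apply: (@bound _ (`|w|^-1 *: w)).
    split; first by apply: linsubZ => //; exact: linsub_coboundaries.
    by move=> v Dv; rewrite !innerZl yw.
  by rewrite normrZ normfV normr_id mulVf ?normr_eq0.
by rewrite normrZ normfV normr_id ler_pdivrMl// mulrC.
Qed.

(** The range of d^* is closed: by [poincare_dadj] the preimages of a Cauchy sequence are Cauchy,
    their limit is a coboundary because the coboundaries are closed, and the adjoint relation passes
    to the limit. *)
Lemma complete_dadj : closed (coboundaries W k) ->
  complete_for [set w | exists y, dadj y w] (fun x => `|x| ^+ 2).
Proof.
move=> Bcl s /choice[t tP] cs.
have [c c0 cP] := poincare_dadj Bcl.
have dadjB n m : dadj (t n - t m) (s n - s m).
  have [[Bn nP] [Bm mP]] := (tP n, tP m).
  split; first by apply: linsubB => //; exact: linsub_coboundaries.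
  by move=> v Dv; rewrite !innerBl nP// mP.
have [w sw] := cauchy_lim cs.
have ct : cauchy_for (fun x => `|x| ^+ 2) t.
  move=> e e0; have [|N HN] := cs (e / c ^+ 2).
    by rewrite divr_gt0// exprn_gt0.
  exists N => n m Nn Nm.
  apply: le_trans (_ : (c * `|s n - s m|) ^+ 2 <= _).
    by rewrite ler_pXn2r ?nnegrE ?mulr_ge0 ?(ltW c0)//; exact: cP.
  by rewrite exprMn mulrC -ler_pdivlMr ?exprn_gt0// HN.
have [y By ty] := complete_closed Bcl (fun n => (tP n).1) ct.
exists w; last exact: cvg_for_norm.
exists y; split => // v Dv.
apply/eqP; rewrite -subr_eq0; apply/eqP.
apply: (@sqr_small _ (2 * (`|d v| ^+ 2 + `|v| ^+ 2))) => e e0.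
have [N1 H1] := ty e e0; have [N2 H2] := cvg_for_norm sw e0.
pose n := maxn N1 N2.
have {H1} h1 := H1 n (leq_maxl _ _); have {H2} h2 := H2 n (leq_maxr _ _).
have := sqr_inner_le (t n - y) (d v); have := sqr_inner_le (s n - w) v.
rewrite !innerBl (tP n).2//.
have := ler_wpM2r (sqr_ge0 `|d v|) h1; have := ler_wpM2r (sqr_ge0 `|v|) h2.
move: (inner (s n) v) (inner w v) (inner y (d v)) => a1 a2 a3.
have := sqr_ge0 (a1 - a2 + (a1 - a3)); lra.
Qed.

(* The range of the adjoint of [d] is the whole orthogonal complement of the  *)
(* cocycles, so [z] there is [d^* y], and [|z|^2 = <y, d z> <= c |z| |d z|].  *)
Lemma poincare_closed : closed (coboundaries W k) ->
  exists2 c, 0 < c & poincare W k c.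
Proof.
move=> Bcl; have [c c0 cP] := poincare_dadj Bcl.
exists c => // z Dz zZ.
have Ds : linsub [set w | exists y, dadj y w].
  split.
    exists 0; split; first exact: (linsub_coboundaries k).1.
    by move=> v _; rewrite !inner0l.
  move=> a w1 w2 [y1 [B1 P1]] [y2 [B2 P2]]; exists (a *: y1 + y2); split.
    exact: (linsub_coboundaries k).2.
  by move=> v Dv; rewrite !innerDl !innerZl P1// P2.
have [w [y yw] wP] := projection z Ds (complete_dadj Bcl).
set m := z - w in wP.
(* The part [m] of [z] orthogonal to the range of d^* vanishes. Indeed m - x = d^* d x lies in that
   range, so |m - x|^2 = - |d x|^2; hence m = x is a cocycle, and it is orthogonal to both [z] and
   [w]. *)
have [x Dx xP] := riesz_dom m.
have mx : inner m (m - x) = 0.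
  apply: wP; exists (d x); split; first by exists x.
  by move=> v Dv; rewrite innerBl -xP// /innerV addrAC subrr add0r.
have xx := xP x Dx.
have mx2 := inner_ge0 (m - x).
have dxE : inner (m - x) (m - x) = - inner (d x) (d x).
  rewrite innerBl mx sub0r innerBr [inner x m]innerC -xx /innerV.
  by move: (inner x x) (inner (d x) (d x)) => ? ?; ring.
have dx0 : d x = 0.
  apply: inner_eq0; apply/eqP; rewrite eq_le inner_ge0 andbT.
  by rewrite -oppr_ge0 -dxE inner_ge0.
have mE : m = x.
  apply/eqP; rewrite -subr_eq0; apply/eqP; apply: inner_eq0.
  by rewrite dxE dx0 inner0l oppr0.
have m0 : m = 0.
  apply: inner_eq0; rewrite {2}/m innerBr (wP w); last by exists y.
  by rewrite innerC zZ ?subr0//; split; rewrite mE.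
have zw : z = w by apply/eqP; rewrite -subr_eq0; apply/eqP.
apply: norm_le_of_inner; first by rewrite mulr_ge0// ltW.
rewrite {1}zw -yw.2//; apply: le_trans (inner_le _ _) _.
by rewrite mulrAC ler_wpM2r// zw cP.
Qed.

End Poincare.

(** * Hodge decomposition and stability *)

Section NormV.
Context {R : realType} {W : hilbert_complex R} {k : int}.
Implicit Types x y : W k.

Lemma innerV_le x y : innerV x y <= normV x * normV y.
Proof.
apply: le_trans (lerD (inner_le x y) (inner_le (d x) (d y))) _.
rewrite -(@ler_pXn2r _ 2) ?nnegrE ?mulr_ge0 ?normV_ge0 ?addr_ge0 ?mulr_ge0//.
rewrite exprMn !sqr_normV !innerVE.
move: `|x| `|y| `|d x| `|d y| => a b a' b'.
have := sqr_ge0 (a * b' - a' * b); lra.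
Qed.

Lemma innerVDl x y z : dom W k x -> dom W k y ->
  innerV (x + y) z = innerV x z + innerV y z.
Proof. by move=> Dx Dy; rewrite /innerV dD// !innerDl addrACA. Qed.

Lemma innerVBl x y z : dom W k x -> dom W k y ->
  innerV (x - y) z = innerV x z - innerV y z.
Proof. by move=> Dx Dy; rewrite /innerV dB// !innerBl opprD addrACA. Qed.

Lemma innerVNr x y : dom W k y -> innerV x (- y) = - innerV x y.
Proof.
by move=> Dy; rewrite /innerV -[- y]scaleN1r dZ// !scaleN1r !innerNr opprD.
Qed.

Lemma normVD x y : dom W k x -> dom W k y -> normV (x + y) <= normV x + normV y.
Proof.
move=> Dx Dy.
rewrite -(@ler_pXn2r _ 2) ?nnegrE ?normV_ge0 ?addr_ge0 ?normV_ge0//.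
rewrite sqrrD !sqr_normV innerVDl// ![innerV _ (x + y)]innerVC !innerVDl//.
by rewrite (innerVC y x); have := innerV_le x y; lra.
Qed.

Lemma normVN x : dom W k x -> normV (- x) = normV x.
Proof.
move=> Dx; rewrite /normV /innerV -scaleN1r dZ// !scaleN1r.
by rewrite !innerNl !innerNr !opprK.
Qed.

Lemma normVB x y : dom W k x -> dom W k y -> normV (x - y) <= normV x + normV y.
Proof.
move=> Dx Dy; rewrite -(normVN Dy); apply: normVD => //.
by rewrite -scaleN1r; apply: linsubZ => //; exact: linsub_dom.
Qed.

Lemma normV_cocycle x : cocycles x -> normV x = `|x|.
Proof.
move=> [Dx dx0]; rewrite /normV innerVE dx0 normr0 expr0n addr0.
by rewrite sqrtr_sqr normr_id.
Qed.

End NormV.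

Section Hodge.
Context {R : realType} {W : hilbert_complex R}.

Lemma cocycle_projection k (x : W k) :
  exists2 z, cocycles z & forall z', cocycles z' -> inner (x - z) z' = 0.
Proof.
exact: projection (linsub_cocycles k) (complete_closed (closed_cocycles (k:=k))).
Qed.

(** Riesz representation for the form <d v, d w> on the complement of the cocycles gives the
    projection together with a controlled potential. The Poincare inequality takes the place of
    closed range, which is not assumed of the discrete complexes. *)
Lemma coboundary_projection k c (x : W (k + 1)) : poincare W k c ->
  exists2 rho : W k, dom W k rho /\ `|rho| <= c * `|d rho| &
    forall b, coboundaries W k b -> inner (x - d rho) b = 0.
Proof.
move=> Pc.
pose D := [set v : W k | dom W k v /\ forall z, cocycles z -> inner v z = 0].
have Ds : linsub D.
  split; first by split; [exact: dom0 | move=> z _; rewrite inner0l].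
  move=> a v w [Dv vZ] [Dw wZ]; split; first exact: dom_lin.
  by move=> z Zz; rewrite innerDl innerZl vZ// wZ// mulr0 addr0.
have DV : complete_for D (fun x => innerV x x).
  move=> s sD cs; have [v Dv sv] := complete_dom (fun n => (sD n).1) cs.
  exists v => //; split=> // z Zz; apply: (@sqr_small _ _ (`|z| ^+ 2)) => e e0.
  have [N HN] := sv e e0.
  rewrite -sqrrN -[- _]add0r -((sD N).2 z Zz) -innerBl.
  apply: le_trans (sqr_inner_le _ _) _; rewrite mulrC ler_wpM2l ?sqr_ge0//.
  by apply: le_trans (HN N (leqnn _)); rewrite innerVE lerDl sqr_ge0.
(* On [D] the Poincare inequality makes |d v| equivalent to the graph norm. *)
have Dd : complete_for D (fun x => inner (d x) (d x)).
  have c1 : 0 < c ^+ 2 + 1 by rewrite ltr_wpDl// sqr_ge0.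
  apply: (complete_equiv Ds c1 _ _ DV) => v [Dv vZ]; last first.
    rewrite innerVE inner_norm.
    have := mulr_ge0 (sqr_ge0 c) (sqr_ge0 `|v|).
    have := mulr_ge0 (sqr_ge0 c) (sqr_ge0 `|d v|).
    by have := sqr_ge0 `|v|; lra.
  rewrite innerVE inner_norm mulrDl mul1r lerD2r -exprMn.
  rewrite ler_pXn2r ?nnegrE ?Pc//.
  exact: le_trans (Pc v Dv vZ).
have [|||||||rho [Drho rhoZ] rhoP] := @riesz _ _ D (fun v w => inner (d v) (d w))
  (fun v => inner x (d v)) (`|x| ^+ 2 + 1) Ds.
- by move=> v w _ _; exact: innerC.
- by move=> a v w z [Dv _] [Dw _] _; rewrite d_lin// innerDl innerZl.
- by move=> v _; exact: inner_ge0.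
- exact: Dd.
- by move=> a v w [Dv _] [Dw _]; rewrite d_lin// innerDr innerZr.
- by rewrite ltr_wpDl// sqr_ge0.
- move=> v _; apply: le_trans (sqr_inner_le _ _) _.
  by rewrite inner_norm ler_wpM2r ?sqr_ge0// lerDl.
exists rho; first by split => //; exact: Pc.
move=> _ [v Dv <-].
have [z [Dz dz] zP] := cocycle_projection v.
have -> : d v = d (v - z) by rewrite dB// dz subr0.
by rewrite innerBl rhoP ?subrr//; split=> //; exact: domB.
Qed.

(** Hodge decomposition of [e]: the part orthogonal to the cocycles is controlled by Poincare, the
    coboundary part d rho by testing with rho, where |rho| + |d rho| <= (c + 1) |d rho|, and the
    harmonic part by testing with itself. *)
Lemma stability k c A g (e : W (k + 1)) : 0 <= c -> 0 <= A -> 0 <= g ->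
  poincare W k c -> poincare W (k + 1) c -> dom W (k + 1) e ->
  (forall t, dom W k t -> inner e (d t) <= A * (`|t| + `|d t|)) ->
  (forall q, harmonics W k q -> inner e q <= g * `|q|) ->
  `|e| <= c * `|d e| + A * (c + 1) + g.
Proof.
move=> c0 A0 g0 Pc Pc' De eB eH.
have [z Zz zP] := cocycle_projection e.
have [rho [Drho rhoc] rhoP] := coboundary_projection z Pc.
have Zr : cocycles (d rho) := cocycles_d Drho.
have eE w : cocycles w -> inner e w = inner z w.
  by move=> Zw; apply/eqP; rewrite -subr_eq0 -innerBl zP.
have h1 : `|e - z| <= c * `|d e|.
  have := Pc' (e - z) (domB De Zz.1) zP.
  by rewrite dB ?Zz.2 ?subr0//; exact: Zz.1.
have h2 : `|d rho| <= A * (c + 1).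
  apply: norm_le_of_inner; first by rewrite mulr_ge0// addr_ge0.
  have -> : inner (d rho) (d rho) = inner e (d rho).
    have Br : coboundaries W k (d rho) by exists rho.
    by rewrite eE//; apply/esym/eqP; rewrite -subr_eq0 -innerBl rhoP.
  apply: le_trans (eB _ Drho) _; rewrite -mulrA ler_wpM2l//.
  by rewrite mulrDl mul1r lerD2r.
have Zh : cocycles (z - d rho) by apply: linsubB => //; exact: linsub_cocycles.
have h3 : `|z - d rho| <= g.
  apply: norm_le_of_inner => //.
  apply: le_trans (eH (z - d rho) _); last by split.
  rewrite eE// -subr_ge0 -innerBl subKr innerC rhoP//; last by exists rho.
have -> : `|e| = `|(e - z) + d rho + (z - d rho)|.
  by rewrite -addrA [d rho + _]addrC !subrK.
apply: le_trans (ler_normD _ _) _; apply: lerD => //.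
by apply: le_trans (ler_normD _ _) _; apply: lerD.
Qed.

End Hodge.

(** * Bounded morphisms between complexes *)

Section Discrete.
Context {R : realType} {W Wh : hilbert_complex R}.
Variables (i : forall j : int, {linear Wh j -> W j}).
Variables (pi : forall j : int, W j -> Wh j).
Hypotheses (i_morph : is_morphism i) (pi_morph : is_morphism pi).
Variable K : R.
Hypothesis K_ge0 : 0 <= K.

Lemma dom_i k (x : Wh k) : dom Wh k x -> dom W k (i k x).
Proof. by have [_ + _] := i_morph k; apply. Qed.

Lemma d_i k (x : Wh k) : dom Wh k x -> d (i k x) = i (k + 1) (d x).
Proof. by have [_ _ +] := i_morph k => h /h. Qed.

Lemma dom_pi k (v : W k) : dom W k v -> dom Wh k (pi v).
Proof. by have [_ + _] := pi_morph k; apply. Qed.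

Lemma d_pi k (v : W k) : dom W k v -> d (pi v) = pi (d v).
Proof. by have [_ _ +] := pi_morph k => h /h. Qed.

Lemma piB k (v w : W k) : dom W k v -> dom W k w -> pi (v - w) = pi v - pi w.
Proof.
move=> Dv Dw; have [pl _ _] := pi_morph k.
by rewrite addrC -scaleN1r pl// scaleN1r addrC.
Qed.

Lemma cocycles_i k (x : Wh k) : cocycles x -> cocycles (i k x).
Proof. by move=> [Dx dx]; split; [exact: dom_i | rewrite d_i// dx linear0]. Qed.

Lemma coboundaries_i k (x : Wh (k + 1)) :
  coboundaries Wh k x -> coboundaries W k (i (k + 1) x).
Proof. by move=> [y Dy <-]; exists (i k y); [exact: dom_i | exact: d_i]. Qed.

Lemma coboundaries_pi k (x : W (k + 1)) :
  coboundaries W k x -> coboundaries Wh k (pi x).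
Proof. by move=> [y Dy <-]; exists (pi y); [exact: dom_pi | exact: d_pi]. Qed.

Lemma cocycles_pi k (x : W k) : cocycles x -> cocycles (pi x).
Proof.
move=> [Dx dx]; split; first exact: dom_pi.
rewrite d_pi// dx -(subrr 0) piB ?subrr//; exact: dom0.
Qed.

Section Degree.
Variable k : int.
Hypothesis i_bounded : forall x : Wh k, `|i k x| <= K * `|x|.
Hypothesis id_bounded : forall x : Wh (k + 1), `|i (k + 1) x| <= K * `|x|.
Hypothesis pi_bounded : forall v : W k, dom W k v -> normV (pi v) <= K * normV v.
Hypothesis pi_i : forall x : Wh k, dom Wh k x -> pi (i k x) = x.
Hypothesis pi_id : forall x : Wh (k + 1), dom Wh (k + 1) x -> pi (i (k + 1) x) = x.

(* If [z] has [d z = d (i v)] and is orthogonal to the cocycles, then         *)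
(* [v - pi z] is a discrete cocycle, so [v] is no larger than [pi z].         *)
Lemma poincare_discrete c : 0 <= c -> poincare W k c ->
  poincare Wh k (K * (c + 1) * K).
Proof.
move=> c0 Pc v Dv vZ.
have [w Zw wP] := cocycle_projection (i k v).
set z := i k v - w in wP.
have Dz : dom W k z by apply: domB; [exact: dom_i | exact: Zw.1].
have dz : d z = i (k + 1) (d v).
  by rewrite /z dB ?d_i// ?Zw.2 ?subr0//; [exact: dom_i | exact: Zw.1].
have Zv : cocycles (v - pi z).
  split; first by apply: domB => //; exact: dom_pi.
  by rewrite dB ?d_pi ?dz ?pi_id ?subrr//; [exact: d_dom | exact: dom_pi].
have nz : normV z <= (c + 1) * (K * `|d v|).
  apply: le_trans (normV_le z) _; rewrite mulrDl mul1r dz lerD//.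
  by apply: le_trans (Pc z Dz wP) _; rewrite dz ler_wpM2l.
apply: norm_le_of_inner; first by rewrite !mulr_ge0// addr_ge0.
have -> : inner v v = inner (pi z) v.
  by apply/eqP; rewrite -subr_eq0 -innerBl innerC vZ.
apply: le_trans (inner_le _ _) _; rewrite ler_wpM2r//.
apply: le_trans (norm_le_normV _) _; apply: le_trans (pi_bounded Dz) _.
by rewrite -!mulrA ler_wpM2l.
Qed.

Lemma normV_i x : dom Wh k x -> normV (i k x) <= K * normV x.
Proof.
move=> Dx; rewrite -(@ler_pXn2r _ 2) ?nnegrE ?mulr_ge0 ?normV_ge0//.
rewrite exprMn !sqr_normV !innerVE mulrDr -!exprMn d_i//.
by rewrite lerD// ler_pXn2r ?nnegrE ?mulr_ge0.
Qed.

Lemma normV_pi_i x : dom Wh k x -> normV x <= K * normV (i k x).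
Proof. by move=> Dx; have := pi_bounded (dom_i Dx); rewrite pi_i. Qed.

(** Since pi_h is a bounded left inverse of i_h, the V-form pulled back by i_h is equivalent to the
    V_h-form, hence complete. The projection therefore exists and no default value is taken. *)
Lemma projVhP v : dom W k v -> dom Wh k (projVh i v) /\
  forall z, dom Wh k z -> innerV (v - i k (projVh i v)) (i k z) = 0.
Proof.
move=> Dv.
have Ds := @linsub_dom _ Wh k.
have dc : complete_for (dom Wh k) (fun x => innerV (i k x) (i k x)).
  have K1 : 0 < K ^+ 2 + 1 by rewrite ltr_wpDl// sqr_ge0.
  apply: (complete_equiv Ds K1 _ _ (@complete_dom _ Wh k)) => x Dx;
    rewrite -!sqr_normV mulrDl mul1r -exprMn ler_wpDr ?sqr_ge0//
      ler_pXn2r ?nnegrE ?mulr_ge0 ?normV_ge0//.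
  - exact: normV_pi_i.
  - exact: normV_i.
have [|||||||y Dy yP] := @riesz _ _ (dom Wh k) (fun x y => innerV (i k x) (i k y))
  (fun z => innerV v (i k z)) (normV v ^+ 2 + 1) Ds.
- by move=> x y _ _; exact: innerVC.
- move=> a x y z Dx Dy _; rewrite linearP innerV_lin//; exact: dom_i.
- by move=> x _; exact: innerV_ge0.
- exact: dc.
- by move=> a x y Dx Dy; rewrite linearP innerVC innerV_lin ?[innerV v _]innerVC//;
    try exact: dom_i; rewrite [innerV v _]innerVC.
- by rewrite ltr_wpDl// sqr_ge0.
- move=> x Dx; rewrite -sqr_normV mulrDl mul1r -exprMn.
  rewrite ler_wpDr ?sqr_ge0//.
  rewrite -[leLHS]real_normK ?num_real// ler_pXn2r ?nnegrE ?mulr_ge0 ?normV_ge0//.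
  have Dix := dom_i Dx.
  rewrite ler_norml innerV_le andbT -[leRHS]opprK lerN2 -innerVNr//.
  by rewrite -(normVN Dix) innerV_le.
have iy : [set y | (i k @` dom Wh k) y /\
    forall z, (i k @` dom Wh k) z -> innerV (v - y) z = 0] (i k y).
  split; first by exists y.
  move=> _ [z Dz <-]; rewrite innerVBl ?yP ?subrr//; exact: dom_i.
have [[w Dw wE] wP] : [set y | (i k @` dom Wh k) y /\
    forall z, (i k @` dom Wh k) z -> innerV (v - y) z = 0]
    (oproj (@innerV R W k) (i k @` dom Wh k) v).
  by rewrite /oproj; case: xgetP => // /(_ (i k y)).
rewrite /projVh; case: xgetP => [x _ [Dx ->]|/(_ w)]; last by case.
by split => // z Dz; apply: wP; exists z.
Qed.

Lemma projVh_min v z : dom W k v -> dom Wh k z ->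
  normV (v - i k (projVh i v)) <= normV (v - i k z).
Proof.
move=> Dv Dz; have [DP PP] := projVhP Dv.
have [DiP Diz] := (dom_i DP, dom_i Dz).
have DvP := domB Dv DiP.
have -> : v - i k z = (v - i k (projVh i v)) + i k (projVh i v - z).
  by rewrite linearB addrA subrK.
set a := v - _; set b := i k (_ - z).
have Db : dom W k b by apply: dom_i; exact: domB.
rewrite -(@ler_pXn2r _ 2) ?nnegrE ?normV_ge0// !sqr_normV.
rewrite (innerVDl _ DvP Db) ![innerV _ (a + b)]innerVC !(innerVDl _ DvP Db).
rewrite [innerV b a]innerVC.
rewrite PP; last exact: domB.
by rewrite add0r addr0 lerDl innerV_ge0.
Qed.

Lemma projVh_bound v : dom W k v -> normV (projVh i v) <= 2 * K * normV v.
Proof.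
move=> Dv; have [DP _] := projVhP Dv; have DiP := dom_i DP.
apply: le_trans (normV_pi_i DP) _; rewrite -mulrA mulrCA ler_wpM2l//.
have -> : i k (projVh i v) = v - (v - i k (projVh i v)) by rewrite subKr.
apply: le_trans (normVB Dv (domB Dv DiP)) _; rewrite mulr_natl mulr2n lerD2l.
by apply: le_trans (projVh_min Dv (@dom0 _ Wh k)) _; rewrite linear0 subr0.
Qed.

Lemma normd_sub_i v z : dom W k v -> dom Wh k z ->
  `|d v - i (k + 1) (d z)| <= normV (v - i k z).
Proof.
move=> Dv Dz; rewrite -d_i// -dB//; last exact: dom_i.
exact: normd_le_normV.
Qed.

Lemma projVh_dist v : dom W k v ->
  normV (v - i k (projVh i v)) <= distV v (i k @` dom Wh k).
Proof.
move=> Dv; apply: lb_le_inf.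
  by exists (normV (v - i k 0)), (i k 0) => //; exists 0 => //; exact: dom0.
by move=> _ [_ [z Dz <-] <-]; exact: projVh_min.
Qed.

(** I - i pi vanishes on i V_h, so it sees only the error of the V-projection. *)
Lemma pi_quasi_optimal v : dom W k v ->
  normV (v - i k (pi v)) <= (1 + K ^+ 2) * normV (v - i k (projVh i v)).
Proof.
move=> Dv; have [DP _] := projVhP Dv.
set z := projVh i v in DP *.
have Diz := dom_i DP; have Dvz := domB Dv Diz.
have -> : v - i k (pi v) = (v - i k z) - i k (pi (v - i k z)).
  by rewrite piB// pi_i// linearB opprB addrA subrK.
apply: le_trans (normVB Dvz _) _; first exact/dom_i/dom_pi.
rewrite mulrDl mul1r lerD2l; apply: le_trans (normV_i (dom_pi Dvz)) _.
by rewrite expr2 -mulrA ler_wpM2l// pi_bounded.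
Qed.

End Degree.

End Discrete.

(** * Defect of unitarity and harmonic forms *)

Section Defect.
Context {R : realType} {W Wh : hilbert_complex R}.
Variables (i : forall j : int, {linear Wh j -> W j}) (k : int) (K : R).
Hypothesis K_ge0 : 0 <= K.
Hypothesis i_bounded : forall x : Wh k, `|i k x| <= K * `|x|.

Lemma J_inner (x y : Wh k) : inner x (J i y) = inner (i k x) (i k y).
Proof. exact: adjointP i_bounded _. Qed.

Lemma JZ (a : R) (x : Wh k) : J i (a *: x) = a *: J i x.
Proof.
suff h z : inner z (J i (a *: x) - a *: J i x) = 0.
  by apply/eqP; rewrite -subr_eq0; apply/eqP; apply: inner_eq0; exact: h.
by rewrite innerBr innerZr !J_inner linearZ/= innerZr subrr.
Qed.

(** A [sup] dominates its set only if the set is bounded above; here |J y| <= K^2 |y|. *)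
Lemma defect_ubound :
  has_ubound [set `|x - J i x| | x in [set x : Wh k | `|x| <= 1]].
Proof.
exists (1 + K * K) => _ [y y1 <-].
apply: le_trans (ler_normB _ _) _; apply: lerD => //.
apply: norm_le_of_inner; first by rewrite mulr_ge0.
rewrite J_inner; apply: le_trans (inner_le _ _) _.
apply: le_trans (ler_wpM2l (normr_ge0 _) (i_bounded y)) _.
apply: le_trans (ler_wpM2r _ (i_bounded _)) _; first by rewrite mulr_ge0.
rewrite [leLHS](_ : _ = K * K * `|J i y| * `|y|); last by ring.
by rewrite ler_piMr// !mulr_ge0.
Qed.

Lemma defectJ_le (x : Wh k) : `|x - J i x| <= defectJ i k * `|x|.
Proof.
have [->|x0] := eqVneq x 0.
  by rewrite -[X in J i X](scale0r 0) JZ scale0r subrr !normr0 mulr0.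
have nx : 0 < `|x| by rewrite normr_gt0.
have : `|(`|x|^-1 *: x) - J i (`|x|^-1 *: x)| <= defectJ i k.
  apply: ub_le_sup; first exact: defect_ubound.
  exists (`|x|^-1 *: x) => //=.
  by rewrite normrZ normfV normr_id mulVf// gt_eqF.
by rewrite JZ -scalerBr normrZ normfV normr_id ler_pdivrMl// mulrC.
Qed.

(** The difference is <(I - J) x, y>_h. Any [nu] above the defect is allowed, so that the maximum
    over the degrees can be used. *)
Lemma inner_defect (x y : Wh k) nu : defectJ i k <= nu ->
  `|inner x y - inner (i k x) (i k y)| <= nu * `|x| * `|y|.
Proof.
move=> Jnu; rewrite [inner x y]innerC -J_inner [inner x _]innerC -innerBl.
apply: le_trans (cauchy_schwarz _ _) _; rewrite -mulrA [`|x| * _]mulrC mulrA.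
by rewrite ler_wpM2r// (le_trans (defectJ_le _))// ler_wpM2r.
Qed.

Lemma defectJ_ge0 : 0 <= defectJ i k.
Proof.
apply: le_trans (normr_ge0 (0 - J i 0)) _; apply: ub_le_sup; first exact: defect_ubound.
by exists 0 => //=; rewrite normr0.
Qed.

End Defect.

Lemma coboundary_oproj (R : realType) (W : hilbert_complex R) (k : int)
  (u : W (k + 1)) : closed (coboundaries W k) ->
  coboundaries W k (oproj inner (coboundaries W k) u) /\
  forall b, coboundaries W k b ->
    inner (u - oproj inner (coboundaries W k) u) b = 0.
Proof.
move=> Bcl.
have [y By yP] := projection u (linsub_coboundaries k) (complete_closed Bcl).
by rewrite /oproj; case: xgetP => [z _ //|/(_ y)]; case.
Qed.

(** * Comparison of continuous and discrete harmonic forms *)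

Section Harmonic.
Context {R : realType} {W Wh : hilbert_complex R}.
Variables (i : forall j : int, {linear Wh j -> W j}).
Variables (pi : forall j : int, W j -> Wh j).
Hypotheses (i_morph : is_morphism i) (pi_morph : is_morphism pi).
Variables (l : int) (K : R).
Hypothesis K_ge0 : 0 <= K.
Hypothesis i_bounded : forall x : Wh (l + 1), `|i (l + 1) x| <= K * `|x|.
Hypothesis id_bounded :
  forall x : Wh (l + 1 + 1), `|i (l + 1 + 1) x| <= K * `|x|.
Hypothesis pi_bounded : forall v : W (l + 1), dom W (l + 1) v ->
  normV (pi v) <= K * normV v.
Hypothesis pi_i : forall x : Wh (l + 1), dom Wh (l + 1) x -> pi (i (l + 1) x) = x.

Let mu := harmonic_gap i pi l.
Let ii := i (l + 1).
Let nu := defectJ i (l + 1).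
Let nu_ge0 : 0 <= nu := defectJ_ge0 K_ge0 i_bounded.

Let piZ (a : R) (v : W (l + 1)) : dom W (l + 1) v -> pi (a *: v) = a *: pi v.
Proof.
move=> Dv; have [pl _ _] := pi_morph (l + 1).
have := pl a v 0 Dv (@dom0 _ W (l + 1)); rewrite addr0 => ->.
suff -> : pi (0 : W (l + 1)) = 0 by rewrite addr0.
by rewrite -{1}(subrr v) (piB pi_morph)// subrr.
Qed.

Lemma pi_cocycle_le (r : W (l + 1)) : cocycles r -> `|pi r| <= K * `|r|.
Proof.
move=> Zr; rewrite -(normV_cocycle Zr).
exact: le_trans (norm_le_normV _) (pi_bounded Zr.1).
Qed.

Let defect_pi_le (r : W (l + 1)) :
  cocycles r -> `|r - ii (pi r)| <= (1 + K ^+ 2) * `|r|.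
Proof.
move=> Zr; rewrite mulrDl mul1r; apply: le_trans (ler_normB _ _) _.
rewrite lerD2l; apply: le_trans (i_bounded _) _.
by rewrite expr2 -mulrA ler_wpM2l// pi_cocycle_le.
Qed.

Let gap_ubound : has_ubound [set `|r - ii (pi r)|
  | r in [set r | harmonics W l r /\ `|r| = 1]].
Proof.
exists (1 + K ^+ 2) => _ [r [[Zr _] r1] <-].
by have := defect_pi_le Zr; rewrite r1 mulr1.
Qed.

Lemma harmonic_gap_ge0 : 0 <= mu.
Proof.
rewrite /mu /harmonic_gap; have := gap_ubound; rewrite /ii.
set A := [set _ | _ in _] => ubA.
have [->|/set0P[x Ax]] := eqVneq A set0; first by rewrite sup0.
apply: le_trans (ub_le_sup ubA Ax); case: Ax => r _ <-; exact: normr_ge0.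
Qed.

Lemma harmonic_gap_le r : harmonics W l r -> `|r - ii (pi r)| <= mu * `|r|.
Proof.
move=> [Zr rB]; have [->|r0] := eqVneq r 0.
  have [pl _ _] := pi_morph (l + 1).
  have := piZ 0 (@dom0 _ W (l + 1)); rewrite !scale0r => ->.
  by rewrite linear0 subrr !normr0 mulr0.
have nr : 0 < `|r| by rewrite normr_gt0.
have : `|(`|r|^-1 *: r) - ii (pi (`|r|^-1 *: r))| <= mu.
  apply: ub_le_sup; first exact: gap_ubound.
  exists (`|r|^-1 *: r) => //; split; last first.
    by rewrite normrZ normfV normr_id mulVf// gt_eqF.
  split; first by apply: linsubZ => //; exact: linsub_cocycles.
  by move=> b Bb; rewrite innerZl rB// mulr0.
rewrite piZ; last exact: Zr.1.
by rewrite linearZ -scalerBr normrZ normfV normr_id ler_pdivrMl// mulrC.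
Qed.

(** Write i q = r + b with r harmonic. Since q = pi r + pi b, one has b = i pi b - (r - i pi r).
    Pairing [b] with i pi b gives only a defect, because q is orthogonal to the discrete coboundary
    pi b; the rest is the gap of r. *)
Lemma harmonic_coboundary c q : poincare W l c -> harmonics Wh l q ->
  exists2 b, coboundaries W l b /\ harmonics W l (ii q - b) &
    `|b| <= K * (nu + mu) * `|q|.
Proof.
move=> Pc [Zq qB].
have Ziq : cocycles (ii q) := cocycles_i i_morph Zq.
have [rho [Drho _] rhoP] := coboundary_projection (ii q) Pc.
have Bb : coboundaries W l (d rho) by exists rho.
set b := d rho in rhoP Bb *.
have Zb := coboundaries_cocycles Bb.
set r := ii q - b.
have Hr : harmonics W l r.
  by split=> //; apply: linsubB => //; exact: linsub_cocycles.
exists b; first by split.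
have rle : `|r| <= K * `|q|.
  apply: le_trans (i_bounded q); apply: norm_le_of_inner => //.
  rewrite [leLHS](_ : _ = inner (ii q) r); first exact: inner_le.
  by rewrite {1}/r innerBl [inner b r]innerC rhoP// subr0.
have qE : q = pi r + pi b.
  by rewrite /r (piB pi_morph) ?subrK ?pi_i//; [exact: Zq.1 | exact: Ziq.1 | exact: Zb.1].
have Bpb : coboundaries Wh l (pi b) := coboundaries_pi pi_morph Bb.
have Bipb : coboundaries W l (ii (pi b)) := coboundaries_i i_morph Bpb.
apply: norm_le_of_inner; first by rewrite !mulr_ge0// addr_ge0// harmonic_gap_ge0.
have -> : inner b b = inner (ii q) (ii (pi b)) - inner q (pi b) - inner b (r - ii (pi r)).
  have iqb : inner (ii q) (ii (pi b)) = inner b (ii (pi b)).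
    by apply/eqP; rewrite -subr_eq0 -innerBl rhoP.
  rewrite iqb qB// subr0 -innerBr.
  suff -> : ii (pi b) - (r - ii (pi r)) = b by [].
  have iqE : ii q = ii (pi b) + ii (pi r) by rewrite -linearD [pi b + _]addrC -qE.
  by rewrite opprB addrA -iqE /r subKr.
have h1 := inner_defect K_ge0 i_bounded q (pi b) (lexx nu).
have h2 := cauchy_schwarz b (r - ii (pi r)).
have h3 := ler_wpM2l (normr_ge0 b) (harmonic_gap_le Hr).
have h4 := pi_cocycle_le Zb.
have h5 : nu * `|q| * `|pi b| <= nu * `|q| * (K * `|b|).
  by rewrite ler_wpM2l// mulr_ge0.
have h6 : `|b| * (mu * `|r|) <= `|b| * (mu * (K * `|q|)).
  by rewrite ler_wpM2l// ler_wpM2l// harmonic_gap_ge0.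
apply: le_trans (ler_norm _) _; apply: le_trans (ler_normB _ _) _.
rewrite distrC [leRHS](_ : _ = nu * `|q| * (K * `|b|) + `|b| * (mu * (K * `|q|))).
  apply: lerD; first exact: le_trans h1 h5.
  by apply: (le_trans h2); exact: le_trans h6.
by ring.
Qed.

(** The form [q] is pi p minus its discrete coboundary part b. That part is small because p is
    orthogonal to i b: |b|^2 is a defect minus <p - i pi p, i b>. *)
Lemma harmonic_approx c p : poincare Wh l c -> harmonics W l p ->
  exists2 q, harmonics Wh l q /\ `|q| <= K * `|p| &
    `|p - ii q| <= (1 + K ^+ 2) * ((1 + K ^+ 2) *
       normV (p - ii (projVh i p)) + nu * `|p|).
Proof.
move=> Pc [Zp pB].
have Zpp := cocycles_pi pi_morph Zp.
have [rho [Drho _] rhoP] := coboundary_projection (pi p) Pc.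
have Bb : coboundaries Wh l (d rho) by exists rho.
set b := d rho in rhoP Bb *.
have Bib : coboundaries W l (ii b) := coboundaries_i i_morph Bb.
have Zb := coboundaries_cocycles Bb.
have ple := pi_cocycle_le Zp.
exists (pi p - b).
  split; first by split=> //; apply: linsubB => //; exact: linsub_cocycles.
  apply: le_trans ple; apply: norm_le_of_inner => //.
  rewrite [leLHS](_ : _ = inner (pi p) (pi p - b)); first exact: inner_le.
  by rewrite innerBl [inner b _]innerC rhoP// subr0.
have ble : `|b| <= K * `|p - ii (pi p)| + nu * (K * `|p|).
  apply: norm_le_of_inner; first by rewrite addr_ge0 ?mulr_ge0.
  have -> : inner b b = inner (pi p) b - inner (ii (pi p)) (ii b) -
      inner (p - ii (pi p)) (ii b).
    rewrite innerBl pB// sub0r opprK subrK.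
    by apply/esym/eqP; rewrite -subr_eq0 -innerBl rhoP.
  have h1 := inner_defect K_ge0 i_bounded (pi p) b (lexx nu).
  have h2 := cauchy_schwarz (p - ii (pi p)) (ii b).
  have h3 := ler_wpM2l (normr_ge0 (p - ii (pi p))) (i_bounded b).
  have h4 : nu * `|pi p| * `|b| <= nu * (K * `|p|) * `|b|.
    by rewrite ler_wpM2r// ler_wpM2l.
  rewrite mulrDl [leRHS]addrC.
  apply: le_trans (ler_norm _) _; apply: le_trans (ler_normB _ _) _.
  apply: lerD; first exact: le_trans h1 h4.
  by apply: (le_trans h2); apply: (le_trans h3); rewrite mulrCA mulrA.
have -> : p - ii (pi p - b) = (p - ii (pi p)) + ii b.
  by rewrite linearB opprB addrA addrAC.
apply: le_trans (ler_normD _ _) _.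
apply: le_trans (lerD (lexx _) (i_bounded b)) _.
have h1 := le_trans (norm_le_normV _)
  (pi_quasi_optimal i_morph pi_morph K_ge0 i_bounded id_bounded pi_bounded pi_i Zp.1).
have K2 : 0 <= 1 + K ^+ 2 by rewrite addr_ge0// sqr_ge0.
apply: le_trans (lerD (lexx _) (ler_wpM2l K_ge0 ble)) _.
have := ler_wpM2l K2 h1; have := mulr_ge0 nu_ge0 (normr_ge0 p).
rewrite -/ii; move: `|p - _| `|p| (normV _) => a1 a2 a3; lra.
Qed.

(** Up to a defect and u - i v, the pairing is <u, i q>, which sees only the coboundary part [b] of
    i q. Subtracting y = pi uB, for which <y, q>_h = 0, pairs the small [b] with the small uB - i y;
    hence the product of mu with an approximation error. *)
Lemma harmonic_residual c (u uB : W (l + 1)) v q : poincare W l c ->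
  (forall r, harmonics W l r -> inner u r = 0) ->
  coboundaries W l uB ->
  (forall b, coboundaries W l b -> inner (u - uB) b = 0) ->
  harmonics Wh l q ->
  `|inner v q| <= (K * `|u - ii v| + nu * `|v| +
    (1 + K ^+ 2) * K * (mu * normV (uB - ii (projVh i uB)) + nu * `|u|)
    + nu * (K * `|u|)) * `|q|.
Proof.
move=> Pc uH BuB uBP Hq.
have ZuB := coboundaries_cocycles BuB.
have [b [Bb Hr] ble] := harmonic_coboundary Pc Hq.
set y := pi uB; set eta := normV (uB - _).
have By : coboundaries Wh l y := coboundaries_pi pi_morph BuB.
have Biy : coboundaries W l (ii y) := coboundaries_i i_morph By.
have uBle : `|uB| <= `|u|.
  apply: norm_le_of_inner => //.
  rewrite [leLHS](_ : _ = inner u uB); first exact: inner_le.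
  by apply/esym/eqP; rewrite -subr_eq0 -innerBl uBP.
have yle : `|y| <= K * `|u|.
  by apply: le_trans (pi_cocycle_le ZuB) _; rewrite ler_wpM2l.
have uiq : inner u (ii q) = inner (uB - ii y) b -
    (inner y q - inner (ii y) (ii q)).
  have -> : inner u (ii q) = inner uB b.
    rewrite -[ii q](subrK b) innerDr uH// add0r.
    by apply/eqP; rewrite -subr_eq0 -innerBl uBP.
  have -> : inner (ii y) (ii q) = inner (ii y) b.
    rewrite -[ii q](subrK b) innerDr [inner _ (_ - b)]innerC.
    by have [_ ->//] := Hr; rewrite add0r.
  have -> : inner y q = 0 by have [_ qB] := Hq; rewrite innerC qB.
  by rewrite sub0r opprK innerBl subrK.
have h1 := inner_defect K_ge0 i_bounded v q (lexx nu).
have h2 := inner_defect K_ge0 i_bounded y q (lexx nu).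
have h3 := le_trans (cauchy_schwarz (u - ii v) (ii q))
  (ler_wpM2l (normr_ge0 _) (i_bounded q)).
have h4 := le_trans (cauchy_schwarz (uB - ii y) b)
  (ler_wpM2l (normr_ge0 _) ble).
have h5 : `|uB - ii y| <= (1 + K ^+ 2) * eta.
  exact: le_trans (norm_le_normV _)
    (pi_quasi_optimal i_morph pi_morph K_ge0 i_bounded id_bounded pi_bounded pi_i ZuB.1).
(* For the part of |b| carrying nu this crude bound suffices, since nu |u| is already an admissible
   term. *)
have h6 : `|uB - ii y| <= (1 + K ^+ 2) * `|u|.
  apply: le_trans (defect_pi_le ZuB) _.
  by rewrite ler_wpM2l// addr_ge0// sqr_ge0.
have h7 : `|uB - ii y| * (K * (nu + mu) * `|q|) <=
    (1 + K ^+ 2) * K * (mu * eta + nu * `|u|) * `|q|.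
  rewrite mulrA ler_wpM2r//.
  have := ler_wpM2l (mulr_ge0 K_ge0 harmonic_gap_ge0) h5.
  have := ler_wpM2l (mulr_ge0 K_ge0 nu_ge0) h6.
  move: `|_ - _| `|u| => a1 a2; lra.
have h8 : nu * `|y| * `|q| <= nu * (K * `|u|) * `|q|.
  by rewrite ler_wpM2r// ler_wpM2l.
have -> : inner v q = (inner v q - inner (ii v) (ii q)) -
    inner (u - ii v) (ii q) + (inner (uB - ii y) b -
    (inner y q - inner (ii y) (ii q))).
  by rewrite -uiq innerBl; ring.
apply: le_trans (ler_normD _ _) _.
apply: le_trans (lerD (ler_normB _ _) (ler_normB _ _)) _.
have := le_trans h4 h7; have := le_trans h2 h8; move: h1 h3.
lra.
Qed.
End Harmonic.

(** * Energy and error estimates *)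

Section Energy.
Context {R : realType} {W : hilbert_complex R}.
Variables (l : int) (c L : R).
Hypotheses (c_ge0 : 0 <= c) (L_ge0 : 0 <= L).
Hypotheses (Pl : poincare W l c) (Pl1 : poincare W (l + 1) c).

(** If X > (B + 1) e, then X^2 > B e X + e X with e X >= B e^2, contradicting the hypothesis. *)
Lemma quadratic_bound (B X e : R) : 0 <= B -> 0 <= X -> 0 <= e ->
  X ^+ 2 <= B * e * (X + e) -> X <= (B + 1) * e.
Proof.
move=> B0 X0 e0 XB; rewrite leNgt; apply/negP => eX.
have : B * e * e <= e * X.
  have : 0 <= e * (X - (B + 1) * e) by rewrite mulr_ge0// subr_ge0 ltW.
  have := sqr_ge0 e; lra.
have : 0 < X * (X - (B + 1) * e).
  rewrite mulr_gt0 ?subr_gt0//; apply: le_lt_trans eX.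
  by rewrite mulr_ge0// addr_ge0.
lra.
Qed.

(** The factor 3 * (...) is the coefficient [B] of the quadratic inequality for Y = |s| + |d e| +
    |r|. The whole sum is at most (c + 3) (1 + L) (Y + eps), where Y <= (B + 1) eps. *)
Definition energy_const := (3 * (c + 5 + 2 * L * (c + 3)) + 2) * (c + 3) * (1 + L).

(* Test with [e + r] to bound [s], [d e] and [r], with [d s] to bound [d s];  *)
(* [stability] then bounds [e].  The term [delta] is the difference of the    *)
(* values of the monotone operator: only its pairing with [e + r] is small.   *)
Lemma energy_estimate (s : W l) (e r delta : W (l + 1)) (eps : R) :
  0 <= eps -> dom W l s -> dom W (l + 1) e -> harmonics W l r ->
  (forall t, dom W l t ->
    `|inner s t - inner e (d t)| <= eps * (`|t| + `|d t|)) ->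
  (forall v, dom W (l + 1) v ->
    `|inner (d s) v + inner (d e) (d v) + inner r v - inner delta v|
      <= eps * (`|v| + `|d v|)) ->
  (forall q, harmonics W l q -> `|inner e q| <= eps * `|q|) ->
  inner delta (e + r) <= `|delta| * eps ->
  `|delta| <= L * (`|e| + `|r| + `|d e| + eps) ->
  `|s| + `|d s| + `|e| + `|d e| + `|r| <= energy_const * eps.
Proof.
move=> eps0 Ds De [[Dr dr0] rB] h1 h2 h3 h4 h5.
have Bds : coboundaries W l (d s) by exists s.
have [Dds dds] := cocycles_d Ds.
have hE : `|e| <= c * `|d e| + (`|s| + eps) * (c + 1) + eps.
  apply: stability => //; first by rewrite addr_ge0.
    move=> t Dt; have := h1 t Dt; rewrite ler_norml => /andP[+ _].
    have := inner_le s t; have := mulr_ge0 (normr_ge0 s) (normr_ge0 (d t)); lra.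
  by move=> q Hq; apply: le_trans (ler_norm _) _; exact: h3.
have hT : `|d s| <= `|delta| + eps.
  apply: norm_le_of_inner; first by rewrite addr_ge0.
  have := h2 _ Dds; rewrite dds inner0r rB// !addr0 normr0 addr0.
  rewrite ler_norml => /andP[_]; have := inner_le delta (d s); lra.
(* Adding the first relation tested with [s] to the second tested with [e + r] cancels <e, d s>. *)
have hY : `|s| ^+ 2 + `|d e| ^+ 2 + `|r| ^+ 2 <= eps * (`|s| + `|d s|) +
    eps * `|r| + eps * (`|e| + `|r| + `|d e|) + `|delta| * eps.
  have := h2 _ (domD De Dr); rewrite dD// dr0 addr0 !innerDr.
  rewrite [inner (d s) r]innerC rB// addr0 !inner_norm.
  have := h1 _ Ds; have := h3 r (conj (conj Dr dr0) rB).
  rewrite !ler_norml inner_norm [inner e (d s)]innerC [inner e r]innerC.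
  have := ler_wpM2l eps0 (ler_normD e r); move: h4; rewrite innerDr.
  by move=> ? ? /andP[? ?] /andP[? ?] /andP[? ?]; lra.
move: h5 hE hT hY; rewrite /energy_const.
move: `|s| `|d s| `|e| `|d e| `|r| `|delta| (normr_ge0 s) (normr_ge0 (d s))
  (normr_ge0 e) (normr_ge0 (d e)) (normr_ge0 r) (normr_ge0 delta).
move=> S T E D Q N S0 T0 E0 D0 Q0 N0 h5 hE hT hY.
set B := 3 * _; pose Y := S + D + Q.
have B0 : 0 <= B by rewrite /B !(mulr_ge0, addr_ge0).
have Y0 : 0 <= Y by rewrite /Y; lra.
have E_le : E <= (c + 2) * (Y + eps).
  apply: le_trans hE _; rewrite /Y.
  have := mulr_ge0 c_ge0 S0; have := mulr_ge0 c_ge0 D0.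
  have := mulr_ge0 c_ge0 Q0; have := mulr_ge0 c_ge0 eps0; lra.
have N_le : N <= L * (c + 3) * (Y + eps).
  apply: le_trans h5 _; rewrite -mulrA ler_wpM2l//.
  by move: E_le; rewrite /Y; lra.
have Y_le : Y <= (B + 1) * eps.
  apply: quadratic_bound => //.
  have Y3 : Y ^+ 2 <= 3 * (S ^+ 2 + D ^+ 2 + Q ^+ 2).
    have := sqr_ge0 (S - D); have := sqr_ge0 (S - Q); have := sqr_ge0 (D - Q).
    by rewrite /Y; lra.
  apply: le_trans Y3 _.
  apply: le_trans (ler_wpM2l _ hY) _ => //.
  have e1 := ler_wpM2l eps0 E_le; have e2 := ler_wpM2l eps0 N_le.
  have e3 := ler_wpM2l eps0 hT.
  have e4 := mulr_ge0 eps0 S0; have e5 := mulr_ge0 eps0 D0.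
  have e6 := mulr_ge0 eps0 Q0; have e7 := sqr_ge0 eps.
  by move: e1 e2; rewrite /B /Y; lra.
have Ye : S + T + E + D + Q <= (c + 3) * (1 + L) * (Y + eps).
  by move: E_le N_le; rewrite /Y; lra.
apply: (le_trans Ye); rewrite [leRHS](_ : _ = (c + 3) * (1 + L) * ((B + 2) * eps)).
  by rewrite ler_wpM2l ?mulr_ge0 ?addr_ge0//; lra.
by ring.
Qed.

End Energy.

(** The energy estimate applies to the solution itself, with the nonlinear term moved into the data:
    delta = 0, L = 0 and eps = |f - F(u+p)|. *)
Lemma mixed_solution_bound (R : realType) (W : hilbert_complex R) (l : int)
    (c : R) (F : W (l + 1) -> W (l + 1)) f (sigma : W l) (u p : W (l + 1)) :
  0 <= c -> poincare W l c -> poincare W (l + 1) c ->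
  mixed_solution F f sigma u p ->
  `|sigma| + `|d sigma| + `|u| + `|d u| + `|p|
    <= energy_const c 0 * `|f - F (u + p)|.
Proof.
move=> c0 Pl Pl1 [Ds Du Hp [e1 e2 e3]].
apply: (@energy_estimate _ _ _ _ _ _ _ _ _ _ _ _ 0) => //.
- by move=> t Dt; rewrite e1// normr0 mulr_ge0// addr_ge0.
- move=> v Dv; rewrite inner0l subr0.
  rewrite [X in `|X|](_ : _ = inner (f - F (u + p)) v).
    apply: le_trans (cauchy_schwarz _ _) _.
    by rewrite ler_wpM2l// lerDl.
  by rewrite innerBl -e2// addrK.
- by move=> q Hq; rewrite e3// normr0 mulr_ge0.
- by rewrite inner0l normr0 mul0r.
- by rewrite normr0 mul0r.
Qed.

Section Sums.
Context {R : realFieldType}.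
Implicit Types a b c d e f : R.

Lemma sum5_bounds a b c d e :
  0 <= a -> 0 <= b -> 0 <= c -> 0 <= d -> 0 <= e ->
  let s := a + b + c + d + e in [/\ a + b <= s, c + d <= s & e <= s].
Proof. by move=> ? ? ? ? ? /=; split; lra. Qed.

Lemma sum6_bounds a b c d e f :
  0 <= a -> 0 <= b -> 0 <= c -> 0 <= d -> 0 <= e -> 0 <= f ->
  let s := a + b + c + d + e + f in
  [/\ a <= s, b <= s, c <= s & [/\ d <= s, e <= s, f <= s & a + b <= s]].
Proof. by move=> ? ? ? ? ? ? /=; split; [lra|lra|lra|split; lra]. Qed.

Lemma sum4_bounds a b c d : 0 <= a -> 0 <= b -> 0 <= c -> 0 <= d ->
  let s := a + b + c + d in [/\ a <= s, b <= s, c <= s & d <= s].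
Proof. by move=> ? ? ? ? /=; split; lra. Qed.

Lemma normD_le a b c d : `|a| <= c -> `|b| <= d -> `|a + b| <= c + d.
Proof. by move=> ac bd; apply: le_trans (ler_normD _ _) (lerD ac bd). Qed.

Lemma normB_le a b c d : `|a| <= c -> `|b| <= d -> `|a - b| <= c + d.
Proof. by move=> ac bd; apply: le_trans (ler_normB _ _) (lerD ac bd). Qed.

End Sums.

(** * The error estimate for a single discrete complex *)

Section Main.
Context {R : realType} {W Wh : hilbert_complex R}.
Variables (i : forall j : int, {linear Wh j -> W j}).
Variables (pi : forall j : int, W j -> Wh j).
Hypotheses (i_morph : is_morphism i) (pi_morph : is_morphism pi).
Variables (l : int) (K c L : R).
Hypotheses (K_ge0 : 0 <= K) (c_ge0 : 0 <= c) (L_ge0 : 0 <= L).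
Hypothesis W_closed : closed (coboundaries W l).
Hypothesis i0 : forall x : Wh l, `|i l x| <= K * `|x|.
Hypothesis i1 : forall x : Wh (l + 1), `|i (l + 1) x| <= K * `|x|.
Hypothesis i2 : forall x : Wh (l + 1 + 1), `|i (l + 1 + 1) x| <= K * `|x|.
Hypothesis pi0 : forall v : W l, dom W l v -> normV (pi v) <= K * normV v.
Hypothesis pi1 : forall v : W (l + 1), dom W (l + 1) v ->
  normV (pi v) <= K * normV v.
Hypothesis pi_i : forall j (x : Wh j), dom Wh j x -> pi (i j x) = x.
Hypotheses (Pl : poincare W l c) (Pl1 : poincare W (l + 1) c).

Let ch := K * (c + 1) * K.
Let ch_ge0 : 0 <= ch.
Proof. by rewrite !mulr_ge0// addr_ge0. Qed.
Let Plh : poincare Wh l ch.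
Proof. exact (poincare_discrete i_morph pi_morph K_ge0 i1 pi0 (@pi_i _) c_ge0 Pl). Qed.
Let Pl1h : poincare Wh (l + 1) ch.
Proof. exact (poincare_discrete i_morph pi_morph K_ge0 i2 pi1 (@pi_i _) c_ge0 Pl1). Qed.

Variables (F : W (l + 1) -> W (l + 1)) (Fh : Wh (l + 1) -> Wh (l + 1)).
Variables (f : W (l + 1)) (fh : Wh (l + 1)).
Variables (sigma : W l) (u p : W (l + 1)).
Variables (sigmah : Wh l) (uh ph : Wh (l + 1)).
Hypothesis sol : mixed_solution F f sigma u p.
Hypothesis solh : mixed_solution Fh fh sigmah uh ph.
Hypothesis Fh_mono : monotone_op Fh.
Hypothesis Fh_lip : forall v w, dom Wh (l + 1) v -> dom Wh (l + 1) w ->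
  `|Fh v - Fh w| <= L * normV (v - w).

Let best k (v : W k) := normV (v - i k (projVh i v)).
Let uB := oproj inner (coboundaries W l) u.
Let mu := harmonic_gap i pi l.
Let g := f - F (u + p).
Let alpha := adjoint (i (l + 1)) g - (fh - Fh (projVh i (u + p))).
Let nu := Num.max (defectJ i l)
  (Num.max (defectJ i (l + 1)) (defectJ i (l + 1 + 1))).

(** The bracket of the theorem, with the error of the V-projection in place of each infimum;
    [projVh_dist] exchanges them at the end. *)
Let rho := best sigma + best u + best p + mu * best uB + `|alpha| + nu * `|g|.

Definition stab_const := energy_const c 0.
Definition harm_const := (1 + K ^+ 2) * (1 + K ^+ 2 + stab_const).
(* The sum of the coefficients in the bounds [res1], [res2], [res3] and       *)
(* [close] below.                                                             *)
Definition consistency_const :=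
  (2 * K + 4 * K * stab_const) + (1 + 2 * K + K * harm_const + 5 * K * stab_const) +
  (K + 3 * K * stab_const + (1 + K ^+ 2) * K * (1 + stab_const)) +
  K * (3 + harm_const).
(** The 1 pays for the projection errors of sigma and u, [harm_const] for p - i q, and the last term
    for i_h applied to the discrete differences. *)
Definition error_const :=
  1 + harm_const + K * (energy_const ch L * consistency_const).

Lemma error_const_ge0 : 0 <= error_const.
Proof.
by rewrite /error_const /consistency_const /harm_const /stab_const /energy_const
  /ch !(mulr_ge0, addr_ge0, sqr_ge0).
Qed.

Lemma error_bound :
  normV (sigma - i l sigmah) + normV (u - i (l + 1) uh)
    + `|p - i (l + 1) ph| <= error_const * rho.
Proof.
have [Ds Du [Zp pB] [e1 e2 e3]] := sol.
have [Dsh Duh [Zph phB] [f1 f2 f3]] := solh.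
have S0 : 0 <= stab_const by rewrite /stab_const /energy_const !(mulr_ge0, addr_ge0).
have nu0 : defectJ i l <= nu by rewrite le_max lexx.
have nu1 : defectJ i (l + 1) <= nu by rewrite !le_max lexx orbT.
have nu2 : defectJ i (l + 1 + 1) <= nu by rewrite !le_max lexx !orbT.
have nu_ge0 : 0 <= nu := le_trans (defectJ_ge0 K_ge0 i0) nu0.
have mu_ge0 : 0 <= mu := harmonic_gap_ge0 K_ge0 i1 pi1.
have best_ge0 k (v : W k) : 0 <= best v := normV_ge0 _.
have [BuB uBP] := coboundary_oproj u W_closed.
have stab := mixed_solution_bound c_ge0 Pl Pl1 sol.
rewrite -/g -/stab_const in stab.
set G := `|g| in stab; have G0 : 0 <= G by exact: normr_ge0.
have nuG : 0 <= nu * G by rewrite mulr_ge0.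
have muB : 0 <= mu * best uB by rewrite mulr_ge0.
have [sG uG pG] : [/\ normV sigma <= stab_const * G, normV u <= stab_const * G &
    `|p| <= stab_const * G].
  have [h1 h2 h3] := sum5_bounds (normr_ge0 sigma) (normr_ge0 (d sigma))
    (normr_ge0 u) (normr_ge0 (d u)) (normr_ge0 p).
  split; last exact: le_trans h3 stab.
    exact: le_trans (le_trans (normV_le _) h1) stab.
  exact: le_trans (le_trans (normV_le _) h2) stab.
have [bs bu bp [bmu bal bnu bsu]] := sum6_bounds (best_ge0 _ sigma)
  (best_ge0 _ u) (best_ge0 _ p) muB (normr_ge0 alpha) nuG.
rewrite -/rho in bs bu bp bmu bal bnu bsu.
have rho_ge0 : 0 <= rho := le_trans muB bmu.
pose s0 := projVh i sigma; pose v0 := projVh i u; pose w0 := projVh i (u + p).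
have [Ds0 _] : dom Wh l s0 /\ _ := projVhP i_morph K_ge0 i0 i1 pi0 (@pi_i _) Ds.
have P1 (v : W (l + 1)) (Dv : dom W (l + 1) v) :=
  (projVhP i_morph K_ge0 i1 i2 pi1 (@pi_i _) Dv).1.
have Dw : dom W (l + 1) (u + p) by apply: domD => //; exact: Zp.1.
have Dv0 : dom Wh (l + 1) v0 := P1 _ Du.
have Dw0 : dom Wh (l + 1) w0 := P1 _ Dw.
have s0G : normV s0 <= 2 * K * (stab_const * G).
  apply: le_trans (projVh_bound i_morph K_ge0 i0 i1 pi0 (@pi_i _) Ds) _.
  by rewrite ler_wpM2l// mulr_ge0.
have v0G : normV v0 <= 2 * K * (stab_const * G).
  apply: le_trans (projVh_bound i_morph K_ge0 i1 i2 pi1 (@pi_i _) Du) _.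
  by rewrite ler_wpM2l// mulr_ge0.
have [q [Hq qp] pq] := harmonic_approx i_morph pi_morph K_ge0 i1 i2 pi1 (@pi_i _)
  Plh (conj Zp pB).
have [Zq qB] := Hq.
have qG : `|q| <= K * (stab_const * G) by apply: le_trans qp _; rewrite ler_wpM2l.
have K2 : 0 <= 1 + K ^+ 2 by rewrite addr_ge0// sqr_ge0.
have H0 : 0 <= harm_const by rewrite mulr_ge0// addr_ge0.
(* The defect only multiplies quantities bounded through the a priori estimate, so it is absorbed by
   the term nu * G of [rho]. *)
have nuS a x : 0 <= a -> 0 <= x -> x <= a * (stab_const * G) ->
    nu * x <= a * stab_const * rho.
  move=> a0 x0 xa; apply: le_trans (ler_wpM2l nu_ge0 xa) _.
  rewrite [leLHS](_ : _ = a * stab_const * (nu * G)); last by ring.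
  by rewrite ler_wpM2l// mulr_ge0.
have pqr : `|p - i (l + 1) q| <= harm_const * rho.
  apply: (le_trans pq); rewrite /harm_const -mulrA ler_wpM2l// [leRHS]mulrDl.
  apply: lerD; first exact: ler_wpM2l.
  rewrite -[stab_const]mul1r; apply: le_trans (nuS 1 `|p| _ _ _) => //.
    by rewrite ler_wpM2r.
  by rewrite mul1r.
have defect k (ik : forall x : Wh k, `|i k x| <= K * `|x|) a (x y : Wh k) N :
    defectJ i k <= nu -> 0 <= a -> `|x| <= a * (stab_const * G) -> `|y| <= N ->
    `|inner x y - inner (i k x) (i k y)| <= a * stab_const * (rho * N).
  move=> nk a0 xa yN; apply: le_trans (inner_defect K_ge0 ik x y nk) _.
  by rewrite mulrA; apply: ler_pM; rewrite ?mulr_ge0//; exact: nuS.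
have consistent k (ik : forall x : Wh k, `|i k x| <= K * `|x|) (x : W k) y a N :
    `|x| <= a -> `|y| <= N -> `|inner x (i k y)| <= K * (a * N).
  move=> xa yN; apply: le_trans (cauchy_schwarz _ _) _.
  apply: le_trans (ler_pM _ _ xa (ik y)) _ => //.
  rewrite mulrCA ler_wpM2l// ler_wpM2l//.
  exact: le_trans xa.
set eps := consistency_const * rho.
have Q0 : 0 <= K * stab_const by rewrite mulr_ge0.
have QH : 0 <= K * harm_const by rewrite mulr_ge0.
have Q3 : 0 <= (1 + K ^+ 2) * K * (1 + stab_const).
  by rewrite !mulr_ge0// addr_ge0.
have [q1 q2 q3 q4] : [/\ 2 * K + 4 * K * stab_const <= consistency_const,
    1 + 2 * K + K * harm_const + 5 * K * stab_const <= consistency_const,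
    K + 3 * K * stab_const + (1 + K ^+ 2) * K * (1 + stab_const)
      <= consistency_const & K * (3 + harm_const) <= consistency_const].
  by apply: sum4_bounds; rewrite !(mulr_ge0, addr_ge0, sqr_ge0).
have eps_ge0 : 0 <= eps.
  by apply: mulr_ge0 => //; apply: le_trans q4; rewrite mulr_ge0// addr_ge0.
have Dis0 := dom_i i_morph Ds0; have Div0 := dom_i i_morph Dv0.
have Diq := dom_i i_morph Zq.1; have Diw0 := dom_i i_morph Dw0.
have s0r : `|sigma - i l s0| <= rho := le_trans (norm_le_normV _) bs.
have v0r : `|u - i (l + 1) v0| <= rho := le_trans (norm_le_normV _) bu.
have ds0r : `|d sigma - i (l + 1) (d s0)| <= rho.
  exact: le_trans (normd_sub_i i_morph Ds Ds0) bs.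
have dv0r : `|d u - i (l + 1 + 1) (d v0)| <= rho.
  exact: le_trans (normd_sub_i i_morph Du Dv0) bu.
have ns0 := le_trans (norm_le_normV s0) s0G.
have nds0 := le_trans (normd_le_normV s0) s0G.
have nv0 := le_trans (norm_le_normV v0) v0G.
have ndv0 := le_trans (normd_le_normV v0) v0G.
have K4 : 0 <= 2 * K by rewrite mulr_ge0.
pose wh := uh + ph; pose dl := Fh w0 - Fh wh.
have Dwh : dom Wh (l + 1) wh by apply: domD => //; exact: Zph.1.
have Dvq : dom Wh (l + 1) (v0 + q) by apply: domD => //; exact: Zq.1.
(* The consistency term evaluates F_h at [w0], while the differences are taken from v0 + q; the two
   points must be close in the V_h-norm. *)
have close : normV (w0 - (v0 + q)) <= eps.
  apply: le_trans (normV_pi_i i_morph pi1 (@pi_i _) (domB Dw0 Dvq)) _.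
  have -> : i (l + 1) (w0 - (v0 + q)) =
      ((u - i (l + 1) v0) + (p - i (l + 1) q)) - (u + p - i (l + 1) w0).
    rewrite linearB linearD [(u - _) + _]addrACA -opprD.
    by rewrite opprB [RHS]addrC addrA subrK.
  have Duv := domB Du Div0; have Dpq := domB Zp.1 Diq; have Dww := domB Dw Diw0.
  have Zpq : cocycles (p - i (l + 1) q).
    by apply: linsubB => //; [exact: linsub_cocycles | exact: (cocycles_i i_morph)].
  have Dz0 := P1 _ Zp.1.
  (* The competitor is [v0] plus the projection of p, with error at most best u + best p. *)
  have ww : normV (u + p - i (l + 1) w0) <= rho + rho.
    apply: le_trans (projVh_min i_morph K_ge0 i1 i2 pi1 (@pi_i _) Dw (domD Dv0 Dz0)) _.
    rewrite linearD opprD addrACA.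
    apply: le_trans (normVD Duv (domB Zp.1 (dom_i i_morph Dz0))) _.
    exact: lerD.
  apply: le_trans (ler_wpM2l K_ge0 (normVB (domD Duv Dpq) Dww)) _.
  apply: le_trans (_ : K * (rho + harm_const * rho + (rho + rho)) <= _).
    rewrite ler_wpM2l// lerD//; apply: le_trans (normVD Duv Dpq) _.
    by rewrite lerD// normV_cocycle.
  rewrite [leLHS](_ : _ = K * (3 + harm_const) * rho); last by ring.
  exact: ler_wpM2r.
have res1 t : dom Wh l t ->
    `|inner (sigmah - s0) t - inner (uh - v0) (d t)| <= eps * (`|t| + `|d t|).
  move=> Dt; set N := `|t| + `|d t|.
  have tN : `|t| <= N by rewrite lerDl.
  have dtN : `|d t| <= N by rewrite lerDr.
  have f1t := subr0_eq (f1 t Dt).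
  have e1t := subr0_eq (e1 _ (dom_i i_morph Dt)); rewrite (d_i i_morph)// in e1t.
  (* Subtracts the continuous equation tested with i t from the discrete one tested with t, leaving
     approximation errors and defects. *)
  have -> : inner (sigmah - s0) t - inner (uh - v0) (d t) =
      inner (sigma - i l s0) (i l t) - inner (u - i (l + 1) v0) (i (l + 1) (d t))
      - (inner s0 t - inner (i l s0) (i l t))
      + (inner v0 (d t) - inner (i (l + 1) v0) (i (l + 1) (d t))).
    by rewrite !innerBl f1t e1t; ring.
  apply: le_trans (normD_le (normB_le (normB_le (consistent _ i0 _ _ _ _ s0r tN)
    (consistent _ i1 _ _ _ _ v0r dtN)) (defect _ i0 _ _ _ _ nu0 K4 ns0 tN))
    (defect _ i1 _ _ _ _ nu1 K4 nv0 dtN)) _.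
  rewrite [leLHS](_ : _ = (2 * K + 4 * K * stab_const) * rho * N); last by ring.
  by rewrite ler_wpM2r ?addr_ge0// ler_wpM2r.
have res2 v : dom Wh (l + 1) v ->
    `|inner (d (sigmah - s0)) v + inner (d (uh - v0)) (d v) + inner (ph - q) v
       - inner dl v| <= eps * (`|v| + `|d v|).
  move=> Dv; set N := `|v| + `|d v|.
  have vN : `|v| <= N by rewrite lerDl.
  have dvN : `|d v| <= N by rewrite lerDr.
  have f2v : inner (d sigmah) v = inner fh v - inner (Fh wh) v - inner ph v
      - inner (d uh) (d v) by rewrite -f2//; ring.
  have e2v : inner (d sigma) (i (l + 1) v) = inner g (i (l + 1) v)
      - inner p (i (l + 1) v) - inner (d u) (i (l + 1 + 1) (d v)).
    rewrite innerBl -e2; last exact: (dom_i i_morph).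
    by rewrite (d_i i_morph)//; ring.
  have alv : inner alpha v = inner g (i (l + 1) v) - inner fh v + inner (Fh w0) v.
    rewrite /alpha innerBl [inner (fh - _) v]innerBl [inner (adjoint _ _) v]innerC.
    by rewrite (adjointP _ i1) [inner (i _ _) g]innerC -/w0; ring.
  have -> : inner (d (sigmah - s0)) v + inner (d (uh - v0)) (d v) +
      inner (ph - q) v - inner dl v =
      inner (d sigma - i (l + 1) (d s0)) (i (l + 1) v)
      + inner (d u - i (l + 1 + 1) (d v0)) (i (l + 1 + 1) (d v))
      + inner (p - i (l + 1) q) (i (l + 1) v)
      - (inner (d s0) v - inner (i (l + 1) (d s0)) (i (l + 1) v))
      - (inner (d v0) (d v) - inner (i (l + 1 + 1) (d v0)) (i (l + 1 + 1) (d v)))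
      - (inner q v - inner (i (l + 1) q) (i (l + 1) v)) - inner alpha v.
    by rewrite !dB// alv !innerBl f2v e2v !innerBl; ring.
  have alN : `|inner alpha v| <= rho * N.
    apply: le_trans (cauchy_schwarz _ _) _; exact: ler_pM.
  apply: le_trans (normB_le (normB_le (normB_le (normB_le (normD_le (normD_le
    (consistent _ i1 _ _ _ _ ds0r vN) (consistent _ i2 _ _ _ _ dv0r dvN))
    (consistent _ i1 _ _ _ _ pqr vN)) (defect _ i1 _ _ _ _ nu1 K4 nds0 vN))
    (defect _ i2 _ _ _ _ nu2 K4 ndv0 dvN)) (defect _ i1 _ _ _ _ nu1 K_ge0 qG vN))
    alN) _.
  rewrite [leLHS](_ : _ = (1 + 2 * K + K * harm_const + 5 * K * stab_const)
    * rho * N); last by ring.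
  by rewrite ler_wpM2r ?addr_ge0// ler_wpM2r.
have res3 r : harmonics Wh l r -> `|inner (uh - v0) r| <= eps * `|r|.
  move=> Hr; rewrite innerBl f3// sub0r normrN.
  apply: le_trans (harmonic_residual i_morph pi_morph K_ge0 i1 i2 pi1 (@pi_i _)
    v0 Pl e3 BuB uBP Hr) _.
  rewrite ler_wpM2r//; apply: le_trans (ler_wpM2r rho_ge0 q3).
  have nuU : nu * `|u| <= stab_const * rho.
    rewrite -[stab_const]mul1r; apply: nuS => //.
    by rewrite mul1r; apply: le_trans (norm_le_normV u) uG.
  have nu1U := le_trans (ler_wpM2r (normr_ge0 u) nu1) nuU.
  rewrite [leRHS](_ : _ = K * rho + 2 * K * stab_const * rho +
    (1 + K ^+ 2) * K * (rho + stab_const * rho) + K * (stab_const * rho));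
    last by ring.
  apply: lerD; last by rewrite mulrCA ler_wpM2l.
  apply: lerD; last by rewrite ler_wpM2l ?mulr_ge0//; exact: lerD.
  apply: lerD; first exact: ler_wpM2l.
  exact: le_trans (ler_wpM2r (normr_ge0 _) nu1) (nuS _ _ K4 (normr_ge0 _) nv0).
have De : dom Wh (l + 1) (uh - v0) by exact: domB.
have Hr : harmonics Wh l (ph - q).
  split; first by apply: linsubB => //; exact: linsub_cocycles.
  by move=> b Bb; rewrite innerBl phB// qB// subrr.
have whE : (uh - v0) + (ph - q) = wh - (v0 + q) by rewrite addrACA -opprD.
have mono : inner dl ((uh - v0) + (ph - q)) <= `|dl| * eps.
  (* The pairing with w0 - wh is nonnegative by monotonicity; the other summand is small by
     [close]. *)
  have -> : (uh - v0) + (ph - q) = (w0 - (v0 + q)) - (w0 - wh).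
    by rewrite whE opprB [RHS]addrC addrA subrK.
  rewrite innerBr; apply: le_trans (_ : inner dl (w0 - (v0 + q)) <= _).
    by rewrite gerDl oppr_le0; exact: Fh_mono.
  apply: le_trans (inner_le _ _) _; rewrite ler_wpM2l//.
  exact: le_trans (norm_le_normV _) close.
have lip : `|dl| <= L * (`|uh - v0| + `|ph - q| + `|d (uh - v0)| + eps).
  apply: le_trans (Fh_lip Dw0 Dwh) _; rewrite ler_wpM2l//.
  have -> : w0 - wh = (w0 - (v0 + q)) - ((uh - v0) + (ph - q)).
    by rewrite whE opprB addrA subrK.
  have Der := domD De Hr.1.1.
  apply: le_trans (normVB (domB Dw0 Dvq) Der) _.
  rewrite [leRHS]addrC; apply: lerD => //.
  apply: le_trans (normV_le _) _; rewrite dD// ?Hr.1.2 ?addr0; last exact: Hr.1.1.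
  by rewrite lerD2r ler_normD.
have En := energy_estimate ch_ge0 L_ge0 Plh Pl1h eps_ge0 (domB Dsh Ds0) De Hr
  res1 res2 res3 mono lip.
have t1 : normV (sigma - i l sigmah) <=
    best sigma + K * (`|sigmah - s0| + `|d (sigmah - s0)|).
  have Dss := domB Dsh Ds0.
  have -> : sigma - i l sigmah = (sigma - i l s0) - i l (sigmah - s0).
    by rewrite linearB opprB addrA subrK.
  apply: le_trans (normVB (domB Ds Dis0) (dom_i i_morph Dss)) _; rewrite lerD2l.
  apply: le_trans (normV_i i_morph K_ge0 i0 i1 Dss) _.
  by rewrite ler_wpM2l// normV_le.
have t2 : normV (u - i (l + 1) uh) <=
    best u + K * (`|uh - v0| + `|d (uh - v0)|).
  have -> : u - i (l + 1) uh = (u - i (l + 1) v0) - i (l + 1) (uh - v0).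
    by rewrite linearB opprB addrA subrK.
  apply: le_trans (normVB (domB Du Div0) (dom_i i_morph De)) _; rewrite lerD2l.
  apply: le_trans (normV_i i_morph K_ge0 i1 i2 De) _.
  by rewrite ler_wpM2l// normV_le.
have t3 : `|p - i (l + 1) ph| <= harm_const * rho + K * `|ph - q|.
  have -> : p - i (l + 1) ph = (p - i (l + 1) q) - i (l + 1) (ph - q).
    by rewrite linearB opprB addrA subrK.
  by apply: le_trans (ler_normB _ _) _; apply: lerD.
apply: le_trans (lerD (lerD t1 t2) t3) _.
rewrite [leLHS](_ : _ = (best sigma + best u) + harm_const * rho +
  K * (`|sigmah - s0| + `|d (sigmah - s0)| + `|uh - v0| + `|d (uh - v0)| +
    `|ph - q|)); last by ring.
rewrite [leRHS](_ : _ = rho + harm_const * rho + K * (energy_const ch L * eps));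
  last by rewrite /error_const /eps; ring.
by rewrite lerD ?lerD2r ?ler_wpM2l.
Qed.

End Main.

Lemma poincare_le (R : realType) (W : hilbert_complex R) (k : int) (c c' : R) :
  c <= c' -> poincare W k c -> poincare W k c'.
Proof.
move=> cc Pc v Dv vZ; apply: le_trans (Pc v Dv vZ) _.
by rewrite ler_wpM2r.
Qed.

Theorem theorem4p3 (R : realType) (W : hilbert_complex R)
  (W_closed : closed_complex W)
  (H : Type) (Wh : H -> hilbert_complex R)
  (i : forall (h : H) (j : int), {linear Wh h j -> W j})
  (pi : forall (h : H) (j : int), W j -> Wh h j)
  (i_morph : forall h, is_morphism (i h))
  (i_inj : forall h j (x y : Wh h j), dom (Wh h) j x -> dom (Wh h) j y ->
    i h j x = i h j y -> x = y)
  (i_bounded : forall j : int, exists c : R, forall h (x : Wh h j),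
    `|i h j x| <= c * `|x|)
  (pi_morph : forall h, is_morphism (pi h))
  (pi_bounded : forall j : int, exists c : R, forall h (v : W j),
    dom W j v -> normV (pi h j v) <= c * normV v)
  (pi_i : forall h j (vh : Wh h j), dom (Wh h) j vh -> pi h j (i h j vh) = vh)
  (l : int)
  (F : W (l + 1) -> W (l + 1)) (Fh : forall h, Wh h (l + 1) -> Wh h (l + 1))
  (F_mono : monotone_op F) (F_hemi : hemicontinuous F)
  (Fh_mono : forall h, monotone_op (Fh h))
  (f : W (l + 1)) (fh : forall h, Wh h (l + 1))
  (sigma : W l) (u p : W (l + 1))
  (sol : mixed_solution F f sigma u p)
  (sigmah : forall h, Wh h l) (uh ph : forall h, Wh h (l + 1))
  (solh : forall h, mixed_solution (Fh h) (fh h) (sigmah h) (uh h) (ph h))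
  (Fh_lip : exists CF : R, forall h (vh wh : Wh h (l + 1)),
    dom (Wh h) (l + 1) vh -> dom (Wh h) (l + 1) wh ->
    `|Fh h vh - Fh h wh| <= CF * normV (vh - wh)) :
  exists C : R, forall h : H,
    let iVh j := i h j @` dom (Wh h) j in
    normV (sigma - i h l (sigmah h)) + normV (u - i h (l + 1) (uh h))
      + `|p - i h (l + 1) (ph h)|
    <= C * (distV sigma (iVh l) + distV u (iVh (l + 1)) + distV p (iVh (l + 1))
        + harmonic_gap (i h) (pi h) l
          * distV (oproj inner (coboundaries W l) u) (iVh (l + 1))
        + `|adjoint (i h (l + 1)) (f - F (u + p))
            - (fh h - Fh h (projVh (i h) (u + p)))|
        + Num.max (defectJ (i h) l)
            (Num.max (defectJ (i h) (l + 1)) (defectJ (i h) (l + 1 + 1)))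
          * `|f - F (u + p)|).
Proof.
have [c1 c1_gt0 P1] := poincare_closed (W_closed l).
have [c2 c2_gt0 P2] := poincare_closed (W_closed (l + 1)).
have c_ge0 : 0 <= c1 + c2 by rewrite addr_ge0// ltW.
have {}P1 : poincare W l (c1 + c2).
  by apply: poincare_le P1; rewrite lerDl ltW.
have {}P2 : poincare W (l + 1) (c1 + c2).
  by apply: poincare_le P2; rewrite lerDr ltW.
have [k0 i0] := i_bounded l; have [k1 i1] := i_bounded (l + 1).
have [k2 i2] := i_bounded (l + 1 + 1).
have [m0 pi0] := pi_bounded l; have [m1 pi1] := pi_bounded (l + 1).
have [CF lip] := Fh_lip.
(* One nonnegative bound for i_h in three degrees and pi_h in two, independent of h. *)
have [K K_ge0 [K0 K1 K2 [M0 M1]]] : exists2 K, 0 <= K &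
    [/\ k0 <= K, k1 <= K, k2 <= K & m0 <= K /\ m1 <= K].
  exists (Num.max 0 (Num.max k0 (Num.max k1 (Num.max k2 (Num.max m0 m1))))).
    by rewrite le_max lexx.
  by rewrite !le_max !lexx !orbT.
have {}i0 h x : `|i h l x| <= K * `|x| by apply: le_trans (i0 h x) _; rewrite ler_wpM2r.
have {}i1 h x : `|i h (l + 1) x| <= K * `|x|.
  by apply: le_trans (i1 h x) _; rewrite ler_wpM2r.
have {}i2 h x : `|i h (l + 1 + 1) x| <= K * `|x|.
  by apply: le_trans (i2 h x) _; rewrite ler_wpM2r.
have {}pi0 h v : dom W l v -> normV (pi h l v) <= K * normV v.
  by move=> Dv; apply: le_trans (pi0 h v Dv) _; rewrite ler_wpM2r// normV_ge0.
have {}pi1 h v : dom W (l + 1) v -> normV (pi h (l + 1) v) <= K * normV v.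
  by move=> Dv; apply: le_trans (pi1 h v Dv) _; rewrite ler_wpM2r// normV_ge0.
(* All arguments are fixed before [h] is introduced. The absolute value gives a nonnegative
   Lipschitz constant whatever the sign of [CF]. *)
exists (error_const K (c1 + c2) `|CF|) => h /=.
have {}lip v w : dom (Wh h) (l + 1) v -> dom (Wh h) (l + 1) w ->
    `|Fh h v - Fh h w| <= `|CF| * normV (v - w).
  move=> Dv Dw; apply: le_trans (lip h v w Dv Dw) _.
  by rewrite ler_wpM2r ?normV_ge0// ler_norm.
have bound := error_bound (i_morph h) (pi_morph h) K_ge0 c_ge0 (normr_ge0 CF)
  (W_closed l) (i0 h) (i1 h) (i2 h) (pi0 h) (pi1 h) (pi_i h) P1 P2 sol (solh h)
  (Fh_mono h) lip.
apply: (le_trans bound); rewrite ler_wpM2l ?error_const_ge0//.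
have [Ds Du [[Dp _] _] _] := sol.
have [BuB _] := coboundary_oproj u (W_closed l).
have dist0 := projVh_dist (i_morph h) K_ge0 (i0 h) (i1 h) (pi0 h) (pi_i h l).
have dist1 := projVh_dist (i_morph h) K_ge0 (i1 h) (i2 h) (pi1 h) (pi_i h (l + 1)).
rewrite lerD2r lerD2r; apply: lerD.
  by apply: lerD; [apply: lerD; [exact: dist0 | exact: dist1] | exact: dist1].
rewrite ler_wpM2l ?(harmonic_gap_ge0 K_ge0 (i1 h) (pi1 h))//.
by apply: dist1; exact: (coboundaries_cocycles BuB).1.
Qed.
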